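(* There exists a square root $G\in\mathcal{S}$ of Thompson's group $F$ such that $G$ does not admit a faithful action by $C^2$ diffeomorphisms on a compact one-manifold or on the real line.
   Context: Let $I=[0,1]$ and let $\mathrm{Homeo}^+(I)$ be the group of orientation-preserving homeomorphisms of $I$. For a homeomorphism $f$, $\operatorname{supp} f=\{x : f(x)\neq x\}$. Two nonempty open intervals $J_1,J_2$ form a two-chain if $J_1\cap J_2$ is a nonempty proper subinterval of $J_1$ and of $J_2$. Thompson's group is $F\cong\langle A,B\mid [A,(AB)^{-1}B(AB)],\ [A,(AB)^{-2}B(AB)^2]\rangle$. A square root of $F$ is a two-generated subgroup $\langle f,g\rangle<\mathrm{Homeo}^+(I)$ such that $\langle f^2,g^2\rangle\cong F$ and such that $\operatorname{supp} f$ and $\operatorname{supp} g$ are open intervals forming a two-chain. $\mathcal{S}$ denotes the set of isomorphism classes of square roots of $F$; $G\in\mathcal S$ means that $G$ is a square root of $F$. The one-manifolds considered are the interval, the circle and the real line, and diffeomorphisms are orientation-preserving. *)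

(* Defs.v *)
From HB Require Import structures.
From mathcomp Require Import all_boot all_order all_algebra generic_quotient.
From mathcomp Require Import all_classical all_reals all_analysis.

Set Implicit Arguments.
Unset Strict Implicit.
Unset Printing Implicit Defensive.

Import Order.TTheory GRing.Theory Num.Theory.
Import numFieldNormedType.Exports.

Local Open Scope classical_set_scope.
Local Open Scope quotient_scope.
Local Open Scope ring_scope.
Local Open Scope group_scope.

Section Generated.
Variables (G : groupType) (A : set G).

Definition gen_pred : {pred G} := fun x =>
  `[< forall H : {pred G},
        group_closed H -> (forall a, A a -> a \in H) -> x \in H >].

Lemma gen_pred_closed : group_closed gen_pred.
Proof.
split; first by apply/asboolP => H [].
move=> x y /asboolP Hx /asboolP Hy; apply/asboolP => H Hc HA.
by apply: (Hc.2); [apply: Hx | apply: Hy].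
Qed.

Record generated := Generated { gen_val : G; gen_valP : gen_val \in gen_pred }.

HB.instance Definition _ := [isSub for gen_val].
HB.instance Definition _ := [Choice of generated by <:].
HB.instance Definition _ :=
  SubChoice_isSubGroup.Build G gen_pred generated gen_pred_closed.

End Generated.

Definition isomorphic (G H : groupType) : Prop :=
  exists phi : {multiplicative G -> H}, bijective phi.

(* Words on the alphabet X; the letter (x, true) stands for the inverse of
   the generator x. *)
Section Presentation.
Variable X : choiceType.

Definition word := seq (X * bool).

Definition letter_inv (l : X * bool) : X * bool := (l.1, ~~ l.2).
Definition word_inv (w : word) : word := rev [seq letter_inv l | l <- w].
Definition word_comm (u v : word) : word := word_inv u ++ word_inv v ++ u ++ v.

Variable rels : seq word.

Inductive pres_eq : word -> word -> Prop :=
| pres_refl u : pres_eq u u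
| pres_sym u v : pres_eq u v -> pres_eq v u
| pres_trans u v w : pres_eq u v -> pres_eq v w -> pres_eq u w
| pres_cancel u l v : pres_eq (u ++ [:: l; letter_inv l] ++ v) (u ++ v)
| pres_rel u r v : r \in rels -> pres_eq (u ++ r ++ v) (u ++ v).

Lemma letter_invK : involutive letter_inv.
Proof. by case=> x b; rewrite /letter_inv /= negbK. Qed.

Lemma pres_eq_ctx u v s t : pres_eq u v -> pres_eq (s ++ u ++ t) (s ++ v ++ t).
Proof.
elim=> {u v} [u|u v _ ?|u v w _ uv _ vw|u l v|u r v rr].
- exact: pres_refl.
- exact: pres_sym.
- exact: pres_trans uv vw.
- by have := pres_cancel (s ++ u) l (v ++ t); rewrite !catA.
- by have := pres_rel (s ++ u) (v ++ t) rr; rewrite !catA.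
Qed.

Lemma pres_eq_cat u u' v v' :
  pres_eq u u' -> pres_eq v v' -> pres_eq (u ++ v) (u' ++ v').
Proof.
move=> uu vv; apply: (@pres_trans _ (u' ++ v)).
  exact: (pres_eq_ctx [::] v uu).
by have := pres_eq_ctx u' [::] vv; rewrite !cats0.
Qed.

Lemma word_inv_cat u v : word_inv (u ++ v) = word_inv v ++ word_inv u.
Proof. by rewrite /word_inv map_cat rev_cat. Qed.

Lemma word_invK : involutive word_inv.
Proof. by move=> u; rewrite /word_inv map_rev revK mapK //; exact: letter_invK. Qed.

Lemma pres_catVw u : pres_eq (word_inv u ++ u) [::].
Proof.
elim: u => [|l u IH]; first exact: pres_refl.
rewrite -cat1s word_inv_cat; apply: pres_trans IH.
have := pres_cancel (word_inv u) (letter_inv l) u.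
by rewrite letter_invK /word_inv /= -!catA.
Qed.

Lemma pres_catwV u : pres_eq (u ++ word_inv u) [::].
Proof. by have := pres_catVw (word_inv u); rewrite word_invK. Qed.

Lemma pres_eq_inv u v : pres_eq u v -> pres_eq (word_inv u) (word_inv v).
Proof.
move=> uv.
apply: (@pres_trans _ (word_inv u ++ v ++ word_inv v)).
  have := pres_eq_cat (pres_refl (word_inv u)) (pres_sym (pres_catwV v)).
  by rewrite cats0.
rewrite catA -[X in pres_eq _ X]cat0s; apply: pres_eq_cat (pres_refl _).
apply: pres_trans (pres_catVw u).
exact: pres_eq_cat (pres_refl _) (pres_sym uv).
Qed.

Definition pres_rel_bool : rel word := fun u v => `[< pres_eq u v >].

Lemma pres_rel_equiv : equiv_class_of pres_rel_bool.
Proof.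
split.
- by move=> u; apply/asboolP; exact: pres_refl.
- by move=> u v; apply/asbool_equiv_eq; split; exact: pres_sym.
- by move=> v u w /asboolP uv /asboolP vw; apply/asboolP; exact: pres_trans uv vw.
Qed.

Canonical pres_equiv := EquivRelPack pres_rel_equiv.

Definition presented := {eq_quot pres_equiv}.
HB.instance Definition _ := Choice.on presented.
HB.instance Definition _ := Quotient.on presented.

Lemma presentedP u v : \pi_presented u = \pi_presented v <-> pres_eq u v.
Proof. by split=> [/eqmodP /asboolP|uv]; last by apply/eqmodP/asboolP. Qed.

Definition presented_one : presented := \pi_presented [::].
Definition presented_mul (x y : presented) : presented := \pi_presented (repr x ++ repr y).
Definition presented_inv (x : presented) : presented := \pi_presented (word_inv (repr x)).

Lemma repr_pres u : pres_eq (repr (\pi_presented u)) u.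
Proof. by apply/presentedP; rewrite reprK. Qed.

Lemma presented_mulE u v :
  presented_mul (\pi_presented u) (\pi_presented v) = \pi_presented (u ++ v).
Proof. by apply/presentedP/pres_eq_cat; exact: repr_pres. Qed.

Lemma presented_invE u :
  presented_inv (\pi_presented u) = \pi_presented (word_inv u).
Proof. by apply/presentedP/pres_eq_inv; exact: repr_pres. Qed.

Lemma presented_mulA : associative presented_mul.
Proof.
elim/quotW=> u; elim/quotW=> v; elim/quotW=> w.
by rewrite (presented_mulE v w) (presented_mulE u v) !presented_mulE catA.
Qed.

Lemma presented_mul1 : left_id presented_one presented_mul.
Proof. by elim/quotW=> u; exact: presented_mulE. Qed.

Lemma presented_mulr1 : right_id presented_one presented_mul.
Proof. by elim/quotW=> u; rewrite (presented_mulE u [::]) cats0. Qed.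

Lemma presented_mulV : left_inverse presented_one presented_inv presented_mul.
Proof.
elim/quotW=> u; rewrite presented_invE presented_mulE.
by apply/presentedP/pres_catVw.
Qed.

Lemma presented_mulrV : right_inverse presented_one presented_inv presented_mul.
Proof.
elim/quotW=> u; rewrite presented_invE presented_mulE.
by apply/presentedP/pres_catwV.
Qed.

HB.instance Definition _ := isGroup.Build presented
  presented_mulA presented_mul1 presented_mulr1 presented_mulV presented_mulrV.

End Presentation.

Definition genA : word bool := [:: (true, false)].
Definition genB : word bool := [:: (false, false)].
Definition genAB : word bool := genA ++ genB.

Definition thompson_rels : seq (word bool) :=
  [:: word_comm genA (word_inv genAB ++ genB ++ genAB);
      word_comm genA
        (word_inv genAB ++ word_inv genAB ++ genB ++ genAB ++ genAB)].

Definition thompsonF : groupType := presented thompson_rels.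

Section HomeoI.
Variable R : realType.

Definition unitI : Type := set_type (`[0%R, 1%R] : set R).

HB.instance Definition _ := Topological.on unitI.

Record homeoI := HomeoI {
  homeo_fun :> unitI -> unitI;
  homeo_inv : unitI -> unitI;
  homeo_funK : cancel homeo_fun homeo_inv;
  homeo_invK : cancel homeo_inv homeo_fun;
  homeo_cont : continuous homeo_fun;
  homeo_inv_cont : continuous homeo_inv;
  homeo_incr : forall x y : unitI,
    (set_val x < set_val y)%R ->
    (set_val (homeo_fun x) < set_val (homeo_fun y))%R
}.

HB.instance Definition _ := gen_eqMixin homeoI.
HB.instance Definition _ := gen_choiceMixin homeoI.

Lemma homeoI_eq (f g : homeoI) : (forall x, f x = g x) -> f = g.
Proof.
case: f g => [f f' fK f'K cf cf' mf] [g g' gK g'K cg cg' mg] /= /funext fg.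
subst g.
have fg' : f' = g' by apply/funext => x; rewrite -{1}(g'K x) fK.
by subst g'; congr HomeoI; exact: Prop_irrelevance.
Qed.

Lemma homeo_inv_incr (f : homeoI) (x y : unitI) :
  (set_val x < set_val y)%R ->
  (set_val (homeo_inv f x) < set_val (homeo_inv f y))%R.
Proof.
move=> xy; rewrite ltNge le_eqVlt; apply/negP => /orP[/eqP|] h.
  have e : homeo_inv f y = homeo_inv f x by exact: val_inj.
  by move: xy; rewrite -(homeo_invK f x) -(homeo_invK f y) e ltxx.
have := homeo_incr f h; rewrite !homeo_invK => /(lt_trans xy).
by rewrite ltxx.
Qed.

Lemma id_cont : continuous (@id unitI).
Proof. by move=> x; exact: cvg_id. Qed.

Definition homeoI_one : homeoI :=
  @HomeoI id id (fun=> erefl) (fun=> erefl) id_cont id_cont (fun _ _ xy => xy).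

Lemma comp_cont (f g : unitI -> unitI) :
  continuous f -> continuous g -> continuous (f \o g).
Proof. by move=> cf cg x; apply: continuous_comp; [exact: cg | exact: cf]. Qed.

Definition homeoI_mul (f g : homeoI) : homeoI :=
  @HomeoI (f \o g) (homeo_inv g \o homeo_inv f)
    (can_comp (homeo_funK f) (homeo_funK g))
    (can_comp (homeo_invK g) (homeo_invK f))
    (comp_cont (homeo_cont (h := f)) (homeo_cont (h := g)))
    (comp_cont (homeo_inv_cont (h := g)) (homeo_inv_cont (h := f)))
    (fun x y xy => homeo_incr f (homeo_incr g xy)).

Definition homeoI_inv (f : homeoI) : homeoI :=
  @HomeoI (homeo_inv f) f (homeo_invK f) (homeo_funK f)
    (homeo_inv_cont (h := f)) (homeo_cont (h := f)) (@homeo_inv_incr f).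

Lemma homeoI_mulA : associative homeoI_mul.
Proof. by move=> f g h; exact: homeoI_eq. Qed.
Lemma homeoI_mul1 : left_id homeoI_one homeoI_mul.
Proof. by move=> f; exact: homeoI_eq. Qed.
Lemma homeoI_mulr1 : right_id homeoI_one homeoI_mul.
Proof. by move=> f; exact: homeoI_eq. Qed.
Lemma homeoI_mulV : left_inverse homeoI_one homeoI_inv homeoI_mul.
Proof. by move=> f; apply: homeoI_eq => x; exact: homeo_funK. Qed.
Lemma homeoI_mulrV : right_inverse homeoI_one homeoI_inv homeoI_mul.
Proof. by move=> f; apply: homeoI_eq => x; exact: homeo_invK. Qed.

HB.instance Definition _ := isGroup.Build homeoI
  homeoI_mulA homeoI_mul1 homeoI_mulr1 homeoI_mulV homeoI_mulrV.

Definition supp (f : homeoI) : set R := [set set_val x | x in [set x | f x <> x]].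

Definition open_interval (J : set R) : Prop :=
  exists a b : R, (a < b)%R /\ J = `]a, b[%classic.

Definition two_chain (J1 J2 : set R) : Prop :=
  [/\ open_interval J1 /\ open_interval J2,
      J1 `&` J2 !=set0 /\ is_interval (J1 `&` J2),
      J1 `&` J2 `<` J1 & J1 `&` J2 `<` J2].

(* The subgroup generated by f and g is a square root of Thompson's group,
   witnessed by the generators f and g. *)
Definition square_root (f g : homeoI) : Prop :=
  isomorphic (generated [set f ^+ 2; g ^+ 2]) thompsonF /\
  two_chain (supp f) (supp g).

End HomeoI.

Section Diffeo.
Variable R : realType.
Local Open Scope ring_scope.

Definition C2 (F : R -> R) : Prop :=
  [/\ forall x, derivable F x 1, forall x, derivable F^`()%classic x 1
    & continuous F^`()^`()%classic].

Definition diffeo_line (f : R -> R) : Prop :=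
  {homo f : x y / x < y} /\
  exists g : R -> R, [/\ cancel f g, cancel g f, C2 f & C2 g].

(* As usual on a manifold with boundary, a map is C^2 up to the boundary when
   it extends to a C^2 map of the ambient line. *)
Definition C2_interval (f : unitI R -> unitI R) : Prop :=
  exists F : R -> R, C2 F /\ forall x, set_val (f x) = F (set_val x).

Definition diffeo_interval (f : unitI R -> unitI R) : Prop :=
  (forall x y, set_val x < set_val y -> set_val (f x) < set_val (f y)) /\
  exists g, [/\ cancel f g, cancel g f, C2_interval f & C2_interval g].

Definition circle : Type := set_type [set z : R * R | z.1 ^+ 2 + z.2 ^+ 2 = 1].

Lemma circle_expP (t : R) :
  (cos (2 * pi * t), sin (2 * pi * t)) \in
  [set z : R * R | z.1 ^+ 2 + z.2 ^+ 2 = 1].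
Proof. by rewrite inE /= cos2Dsin2. Qed.

Definition circle_exp (t : R) : circle := SigSub (circle_expP t).

(* The smooth structure and the orientation of the circle are those for which
   the covering map circle_exp is an orientation-preserving local
   diffeomorphism. *)
Definition C2_circle (f : circle -> circle) : Prop :=
  exists F : R -> R,
    [/\ C2 F, {homo F : s t / s < t}
      & forall t, f (circle_exp t) = circle_exp (F t)].

Definition diffeo_circle (f : circle -> circle) : Prop :=
  exists g, [/\ cancel f g, cancel g f, C2_circle f & C2_circle g].

End Diffeo.

Definition faithful_action (G : groupType) (M : Type) (D : (M -> M) -> Prop)
    (rho : G -> M -> M) : Prop :=
  [/\ forall g, D (rho g),
      forall x, rho 1%g x = x,
      forall g h x, rho (g * h)%g x = rho g (rho h x)
    & forall g, (forall x, rho g x = x) -> g = 1%g].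

Definition acts_faithfully_by (G : groupType) (M : Type)
    (D : (M -> M) -> Prop) : Prop :=
  exists rho : G -> M -> M, faithful_action D rho.

(* Main.v *)
From HB Require Import structures.
Require Import Defs.
From mathcomp Require Import all_boot all_order all_algebra.
From mathcomp Require Import all_classical all_reals all_analysis.
From mathcomp Require Import ring lra zify.

(* The group constructed below contains elements v, r, z with v r v^-1 = r^-1,
   r^2 z r^-2 = z^-1 and z^2 <> 1, and no group with such elements acts faithfully by
   C^2 diffeomorphisms on a one-manifold. Indeed, as v conjugates r to its inverse,
   r^2 has a fixed point (on the circle, one passes to lifts and corrects them by a
   translation). An element reversed by q fixes every fixed point of q, and it has a
   fixed point in every component of the complement of Fix q; on such a component
   q is a contraction towards a fixed point, and the distortion argument of Kopell's
   lemma forces the reversed element to be the identity. Hence z^2 acts trivially.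

   On the group side, let A and B be supported on ]0, +oo[ and ]-oo, 3[ in the line,
   both pushing to the right, with (AB)^-1 mapping 3 to 0; they generate Thompson's
   group, because in the normal form of an element the exponents can be read off
   successively from its action on the points (AB)^-m 3. The square root g of B is
   fixed once and for all, while f, a square root of A, can be prescribed arbitrarily
   on half of a fundamental domain of A. So <f, g> contains, for a suitable commutator
   al of A and B supported on ]0, 3[, an element acting on ]0, 3[ as any given
   homeomorphism phi. The elements v = al, r = [al, phi^-1] and z = [r^2, phi^-1] are
   as required as soon as phi commutes with al^2 and with r^4 but not with r^2. *)

Set Implicit Arguments.
Unset Strict Implicit.
Unset Printing Implicit Defensive.

Import Order.TTheory GRing.Theory Num.Theory.
Import numFieldNormedType.Exports.

(** * Order automorphisms of the line and periodization *)

Section OrderAut.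
Variable R : realType.
Local Open Scope ring_scope.

(** Continuity is not recorded: an increasing bijection of the line is automatically a
    homeomorphism, so maps can be glued piece by piece with no topological check. *)
Record oaut := OAut {
  oaut_fun :> R -> R;
  oaut_inv : R -> R;
  oaut_funK : cancel oaut_fun oaut_inv;
  oaut_invK : cancel oaut_inv oaut_fun;
  oaut_mono : {homo oaut_fun : x y / x < y}
}.

HB.instance Definition _ := gen_eqMixin oaut.
HB.instance Definition _ := gen_choiceMixin oaut.

Lemma oaut_eq (f g : oaut) : (forall x, f x = g x) -> f = g.
Proof.
case: f g => [f f' fK f'K mf] [g g' gK g'K mg] /= /funext fg; subst g.
have fg' : f' = g' by apply/funext => x; rewrite -{1}(g'K x) fK.
by subst g'; congr OAut; exact: Prop_irrelevance.
Qed.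

Lemma oaut_lt (f : oaut) x y : (f x < f y) = (x < y).
Proof.
case: (ltgtP x y) => [/(oaut_mono f)-> //|/(oaut_mono f) yx|->].
- by apply/negbTE; rewrite -leNgt ltW.
- by rewrite ltxx.
Qed.

Lemma oaut_le (f : oaut) x y : (f x <= f y) = (x <= y).
Proof. by rewrite !leNgt oaut_lt. Qed.

Lemma oaut_inv_mono (f : oaut) : {homo oaut_inv f : x y / x < y}.
Proof. by move=> x y xy; rewrite -(oaut_lt f) !oaut_invK. Qed.

Definition oaut_one : oaut :=
  @OAut id id (fun=> erefl) (fun=> erefl) (fun _ _ xy => xy).

Definition oaut_mul (f g : oaut) : oaut :=
  @OAut (f \o g) (oaut_inv g \o oaut_inv f)
    (can_comp (oaut_funK f) (oaut_funK g))
    (can_comp (oaut_invK g) (oaut_invK f))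
    (fun x y xy => oaut_mono f (oaut_mono g xy)).

Definition oaut_opp (f : oaut) : oaut :=
  @OAut (oaut_inv f) f (oaut_invK f) (oaut_funK f) (@oaut_inv_mono f).

Let oaut_mulA : associative oaut_mul.
Proof. by move=> f g h; exact: oaut_eq. Qed.
Let oaut_mul1 : left_id oaut_one oaut_mul.
Proof. by move=> f; exact: oaut_eq. Qed.
Let oaut_mulr1 : right_id oaut_one oaut_mul.
Proof. by move=> f; exact: oaut_eq. Qed.
Let oaut_mulV : left_inverse oaut_one oaut_opp oaut_mul.
Proof. by move=> f; apply: oaut_eq => x; exact: oaut_funK. Qed.
Let oaut_mulrV : right_inverse oaut_one oaut_opp oaut_mul.
Proof. by move=> f; apply: oaut_eq => x; exact: oaut_invK. Qed.

HB.instance Definition _ := isGroup.Build oaut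
  oaut_mulA oaut_mul1 oaut_mulr1 oaut_mulV oaut_mulrV.

Lemma oautM (f g : oaut) x : (f * g)%g x = f (g x).
Proof. by []. Qed.

Lemma oaut1 x : (1%g : oaut) x = x.
Proof. by []. Qed.

Lemma oautK (f : oaut) : cancel f (f^-1)%g.
Proof. exact: oaut_funK. Qed.

Lemma oautVK (f : oaut) : cancel (f^-1)%g f.
Proof. exact: oaut_invK. Qed.

Lemma oautE_V (f : oaut) x y : (f^-1)%g x = y <-> x = f y.
Proof. by split=> [<-|->]; rewrite ?oautVK ?oautK. Qed.

Lemma oaut_ltV (f : oaut) x y : ((f^-1)%g x < y) = (x < f y).
Proof. by rewrite -(oaut_lt f) oautVK. Qed.

Lemma oaut_leV (f : oaut) x y : ((f^-1)%g x <= y) = (x <= f y).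
Proof. by rewrite -(oaut_le f) oautVK. Qed.

Lemma oaut_ltV_r (f : oaut) x y : (x < (f^-1)%g y) = (f x < y).
Proof. by rewrite -(oaut_lt f) oautVK. Qed.

Lemma oaut_leV_r (f : oaut) x y : (x <= (f^-1)%g y) = (f x <= y).
Proof. by rewrite -(oaut_le f) oautVK. Qed.

Lemma oaut_expS (f : oaut) n x : (f ^+ n.+1)%g x = f ((f ^+ n)%g x).
Proof. by rewrite expgS. Qed.

Lemma oaut_fixV (f : oaut) x : f x = x -> (f^-1)%g x = x.
Proof. by move=> fx; apply/oautE_V. Qed.

Lemma oaut_fixX (f : oaut) x n : f x = x -> (f ^+ n)%g x = x.
Proof. by move=> fx; elim: n => // n IH; rewrite oaut_expS IH. Qed.

(** Knaster-Tarski argument: the supremum of the points of [a, b] with [t <= f t] is fixed, by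
    monotonicity alone. *)
Lemma oaut_fix_between (f : oaut) a b :
  a <= b -> a <= f a -> f b <= b -> exists c, [/\ a <= c, c <= b & f c = c].
Proof.
move=> ab fa fb.
pose E := [set t | [/\ a <= t, t <= b & t <= f t]]%classic.
have Ea : E a by [].
have Es : has_sup E by split; [exists a | exists b => t []].
have Eub := sup_upper_bound Es.
pose c := sup E; have ac : a <= c by exact: Eub.
have cb : c <= b by apply: ge_sup; [exists a | move=> t []].
have fc : c <= f c.
  apply: ge_sup; first by exists a.
  move=> t Et; apply: (@le_trans _ _ (f t)); first by case: Et.
  by rewrite oaut_le; exact: Eub.
exists c; split=> //; apply/le_anti; rewrite fc andbT; apply: Eub.
split; [exact: le_trans fc | | by rewrite oaut_le].
by apply: le_trans fb; rewrite oaut_le.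
Qed.

Lemma oaut_fix_between' (f : oaut) a b :
  a <= b -> f a <= a -> b <= f b -> exists c, [/\ a <= c, c <= b & f c = c].
Proof.
move=> ab fa fb.
have [c [ac cb /oautE_V]] : exists c, [/\ a <= c, c <= b & (f^-1)%g c = c].
  by apply: oaut_fix_between => //; rewrite ?oaut_leV ?oaut_leV_r.
by move=> fc; exists c.
Qed.

(** The infimum of the decreasing orbit of [s] is the fixed point. *)
Lemma oaut_orbit_lb (f : oaut) s b : f s <= s ->
  (forall n, b <= (f ^+ n)%g s) -> exists c, [/\ b <= c, c <= s & f c = c].
Proof.
move=> fs hb.
pose E := [set t | exists n, t = (f ^+ n)%g s]%classic.
have En n : E ((f ^+ n)%g s) by exists n.
have Ei : has_inf E by split; [exists s; exact: (En 0%N) | exists b => t [n ->]].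
have Elb n : inf E <= (f ^+ n)%g s by apply: ge_inf (En n); case: Ei.
exists (inf E); split.
- by apply: lb_le_inf; [case: Ei | move=> t [n ->]].
- exact: (Elb 0%N).
- apply/le_anti/andP; split; last first.
    rewrite -oaut_leV; apply: lb_le_inf; first by case: Ei.
    by move=> t [n ->]; rewrite oaut_leV -oaut_expS; exact: Elb.
  apply: lb_le_inf; first by case: Ei.
  move=> t [[|n] ->]; last by rewrite oaut_expS oaut_le; exact: Elb.
  by apply: le_trans fs; rewrite oaut_le; exact: (Elb 0%N).
Qed.

Lemma oaut_orbit_ub (f : oaut) s b : s <= f s ->
  (forall n, (f ^+ n)%g s <= b) -> exists c, [/\ s <= c, c <= b & f c = c].
Proof.
move=> fs hb.
pose E := [set t | exists n, t = (f ^+ n)%g s]%classic.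
have En n : E ((f ^+ n)%g s) by exists n.
have E0 : (E !=set0)%classic by exists s; exact: (En 0%N).
have Ei : has_sup E by split=> //; exists b => t [n ->].
have Eub n : (f ^+ n)%g s <= sup E by exact: (sup_upper_bound Ei).
exists (sup E); split.
- exact: (Eub 0%N).
- by apply: ge_sup => // t [n ->].
- apply/le_anti/andP; split.
    rewrite -oaut_leV_r; apply: ge_sup => //.
    by move=> t [n ->]; rewrite oaut_leV_r -oaut_expS; exact: Eub.
  apply: ge_sup => // t [[|n] ->]; last by rewrite oaut_expS oaut_le; exact: Eub.
  by apply: le_trans fs _; rewrite oaut_le; exact: (Eub 0%N).
Qed.

(** The complement of [D] is stable under [f]: if [f x] lies in [D], then [f] fixes [f x], hence
    also [x]. *)
Lemma oaut_commute_disjoint (f g : oaut) (D : R -> Prop) :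
  (forall x, D x -> f x = x) -> (forall x, ~ D x -> g x = x) ->
  (forall x, D x -> D (g x)) -> commute f g.
Proof.
move=> fD gD DD; apply: oaut_eq => x; rewrite !oautM.
have [Dx|nDx] := pselect (D x); first by rewrite fD ?(fD x) //; exact: DD.
rewrite (gD x) // gD // => Dfx; apply: nDx.
suff <- : f x = x by [].
by apply: (can_inj (oautK f)); rewrite fD.
Qed.

Definition oexpz (h : oaut) (k : int) : oaut :=
  match k with Posz n => (h ^+ n)%g | Negz n => (h ^- n.+1)%g end.

Lemma oexpzS h k : oexpz h (k + 1) = (h * oexpz h k)%g.
Proof.
case: k => [n|[|n]]; first by rewrite -PoszD addn1 /= expgS.
  by rewrite /= expg1 mulgV.
have -> : Negz n.+1 + 1 = Negz n by rewrite !NegzE; lia.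
by rewrite /= [in RHS]expgSr invgM mulVKg.
Qed.

Lemma oexpzSx h k x : oexpz h (k + 1) x = h (oexpz h k x).
Proof. by rewrite oexpzS. Qed.

Lemma oexpz_commute h k : commute h (oexpz h k).
Proof. by case: k => n /=; [|apply: commuteV]; apply: commuteX. Qed.

Lemma oexpzSx' h k x : oexpz h (k + 1) x = oexpz h k (h x).
Proof. by rewrite oexpzS (oexpz_commute h k). Qed.

Lemma oexpz_fix (h : oaut) k c : h c = c -> oexpz h k c = c.
Proof.
move=> hc; case: k => n; rewrite /oexpz; first exact: oaut_fixX.
by apply: oaut_fixV; exact: oaut_fixX.
Qed.

(** * Extending a map from a fundamental domain of [h] to a map commuting with [h] *)

Section Periodize.
Variables (h : oaut) (s : R).
Hypothesis hs : s < h s.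

Lemma oexpz_orbit_lt k l : (oexpz h k s < oexpz h l s) = (k < l).
Proof.
have incr j : oexpz h j s < oexpz h (j + 1) s by rewrite oexpzSx' oaut_lt.
have mono j n : oexpz h j s < oexpz h (j + n.+1%:Z) s.
  elim: n => [|n IH]; first exact: incr.
  by apply: lt_trans IH _; have := incr (j + n.+1%:Z); rewrite -addrA -PoszD addn1.
have aux a b : a < b -> oexpz h a s < oexpz h b s.
  move=> ab; have := mono a (`|b - a| - 1)%N.
  by have -> : a + (`|b - a| - 1).+1%:Z = b by lia.
case: (ltgtP k l) => [/aux-> //|/aux lk|->]; last by rewrite ltxx.
by apply/negbTE; rewrite -leNgt ltW.
Qed.

Lemma oexpz_orbit_le k l : (oexpz h k s <= oexpz h l s) = (k <= l).
Proof. by rewrite !leNgt oexpz_orbit_lt. Qed.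

(** Union of the translates of the fundamental domain [s, h s[. It is the component of the
    complement of the fixed points of [h] that contains [s]. *)
Definition oaut_span (x : R) : Prop :=
  exists k y, [/\ s <= y, y < h s & x = oexpz h k y].

(** The span is the convex hull of the orbit of [s]; the translate containing [x] is found by
    descending from [l]. *)
Lemma oaut_spanP x :
  oaut_span x <-> exists k l, oexpz h k s <= x /\ x < oexpz h l s.
Proof.
split=> [[k [y [sy yh ->]]]|[k [l [kx xl]]]].
  by exists k, (k + 1); rewrite oexpzSx' oaut_le oaut_lt.
have kl : k < l by rewrite -oexpz_orbit_lt; exact: le_lt_trans xl.
have [n ln] : exists n : nat, l = k + n%:Z by exists `|l - k|%N; lia.
rewrite {}ln {kl} in xl; elim: n xl => [|n IH] xl.
  by move: xl; rewrite addr0 ltNge kx.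
case: (ltP x (oexpz h (k + n%:Z) s)) => [/IH //|le].
exists (k + n%:Z), ((oexpz h (k + n%:Z))^-1 x)%g.
rewrite oautVK oaut_leV_r oaut_ltV; split=> //.
by rewrite -oexpzSx' -addrA -PoszD addn1.
Qed.

Lemma oexpz_domain_inj k l y z :
  s <= y -> y < h s -> s <= z -> z < h s -> oexpz h k y = oexpz h l z -> k = l.
Proof.
suff aux a b u v : s <= u -> u < h s -> s <= v -> v < h s ->
    oexpz h a u = oexpz h b v -> (a <= b)%R.
  move=> *; apply/le_anti/andP; split; first exact: (aux _ _ y z).
  exact: (aux _ _ z y).
move=> su uh sv vh e; rewrite leNgt; apply/negP => ba.
have : oexpz h a u < oexpz h a s; last by rewrite oaut_lt ltNge su.
apply: (@lt_le_trans _ _ (oexpz h (b + 1) s)).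
  by rewrite e oexpzSx' oaut_lt.
by rewrite oexpz_orbit_le lezD1.
Qed.

Section Build.
Variable phi : oaut.
Hypotheses (phis : phi s = s) (phih : phi (h s) = h s).

(** Number of the translate of the fundamental domain that contains [x]. The default 0 never
    matters, since [periodize_fun] consults it on the span only. *)
Let index (x : R) : int := xget 0 [set k | s <= ((oexpz h k)^-1 x)%g < h s]%classic.

Definition periodize_fun x :=
  if `[< oaut_span x >] then oexpz h (index x) (phi ((oexpz h (index x))^-1 x)%g)
  else x.

Lemma periodize_funE k y :
  s <= y -> y < h s -> periodize_fun (oexpz h k y) = oexpz h k (phi y).
Proof.
move=> sy yh; rewrite /periodize_fun asboolT; last by exists k, y.
suff -> : index (oexpz h k y) = k by rewrite oautK.
rewrite /index; case: xgetP => [l -> /= /andP[l1 l2]|/(_ k)]; last first.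
  by case; rewrite /mkset oautK sy yh.
symmetry; apply: (@oexpz_domain_inj _ _ y _ sy yh l1 l2).
by rewrite oautVK.
Qed.

Lemma periodize_fun_out x : ~ oaut_span x -> periodize_fun x = x.
Proof. by move=> nx; rewrite /periodize_fun asboolF. Qed.

Lemma periodize_fun_span x : oaut_span x -> oaut_span (periodize_fun x).
Proof.
move=> [k [y [sy yh ->]]]; rewrite periodize_funE //; exists k, (phi y).
by rewrite -[X in X <= _]phis -phih oaut_le oaut_lt.
Qed.

Lemma periodize_fun_mono : {homo periodize_fun : x y / x < y}.
Proof.
have P x k l : oexpz h k s <= x -> x < oexpz h l s -> oaut_span x.
  by move=> kx xl; apply/oaut_spanP; exists k, l.
move=> x y xy.
have [Sx|nSx] := pselect (oaut_span x); have [Sy|nSy] := pselect (oaut_span y).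
- case: Sx xy => k [u [su uh ->]]; case: Sy => l [v [sv vh ->]] xy.
  have uh' : phi u < h s by rewrite -phih oaut_lt.
  have sv' : s <= phi v by rewrite -[X in X <= _]phis oaut_le.
  rewrite !periodize_funE //; case: (ltgtP k l) => [kl|lk|kl].
  + apply: (@lt_le_trans _ _ (oexpz h (k + 1) s)).
      by rewrite oexpzSx' oaut_lt.
    apply: (@le_trans _ _ (oexpz h l s)); last by rewrite oaut_le.
    by rewrite oexpz_orbit_le lezD1.
  + exfalso; move: xy; apply/negP; rewrite -leNgt.
    apply: (@le_trans _ _ (oexpz h (l + 1) s)).
      by rewrite oexpzSx' oaut_le ltW.
    apply: (@le_trans _ _ (oexpz h k s)); last by rewrite oaut_le.
    by rewrite oexpz_orbit_le lezD1.
  + by subst l; move: xy; rewrite !oaut_lt.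
- rewrite (periodize_fun_out nSy).
  have /oaut_spanP[k [l [kx xl]]] := periodize_fun_span Sx.
  have /oaut_spanP[k' [l' [kx' xl']]] := Sx.
  rewrite ltNge; apply/negP => yx; apply: nSy; apply: (P _ k' l).
    by apply: le_trans kx' (ltW xy).
  exact: le_lt_trans xl.
- rewrite (periodize_fun_out nSx).
  have /oaut_spanP[k [l [kx xl]]] := periodize_fun_span Sy.
  have /oaut_spanP[k' [l' [kx' xl']]] := Sy.
  rewrite ltNge; apply/negP => yx; apply: nSx; apply: (P _ k l').
    by apply: le_trans kx _.
  exact: lt_trans xl'.
- by rewrite !periodize_fun_out.
Qed.

End Build.

Lemma periodize_funK (phi psi : oaut) :
  phi s = s -> phi (h s) = h s -> cancel phi psi ->
  cancel (periodize_fun phi) (periodize_fun psi).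
Proof.
move=> ps ph pK x; have [|nx] := pselect (oaut_span x); last first.
  by rewrite !periodize_fun_out // periodize_fun_out.
move=> [k [y [sy yh ->]]]; rewrite !periodize_funE ?pK //.
  by rewrite -[X in X <= _]ps oaut_le.
by rewrite -ph oaut_lt.
Qed.

(** An element of the centralizer of [h] can be prescribed freely on one fundamental domain: copy
    [phi] to each translate by the powers of [h]. *)
Lemma periodize (phi : oaut) : phi s = s -> phi (h s) = h s ->
  exists P : oaut, [/\ commute h P, forall x, s <= x -> x <= h s -> P x = phi x
    & forall x, ~ oaut_span x -> P x = x].
Proof.
move=> ps ph; have vs := oaut_fixV ps; have vh := oaut_fixV ph.
pose P := OAut (periodize_funK ps ph (oautK phi)) (periodize_funK vs vh (oautVK phi))
  (periodize_fun_mono ps ph).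
have PE k y : s <= y -> y < h s -> P (oexpz h k y) = oexpz h k (phi y).
  exact: periodize_funE.
exists P; split.
- apply: oaut_eq => x; rewrite !oautM.
  have [[k [y [sy yh ->]]]|nx] := pselect (oaut_span x).
    by rewrite -oexpzSx !PE // oexpzSx.
  have nhx : ~ oaut_span (h x).
    move=> [k [y [sy yh e]]]; apply: nx; exists (k - 1), y; split=> //.
    by apply: (can_inj (oautK h)); rewrite -oexpzSx subrK.
  by rewrite /P /= !periodize_fun_out.
(* The endpoint [h s] belongs to the next translate, hence the separate case. *)
- move=> x sx; rewrite le_eqVlt => /orP[/eqP->|xh].
    have := PE 1 s (lexx _) hs; rewrite -[1]add0r !oexpzSx' /= ps => ->.
    by rewrite ph.
  exact: (PE 0).
- by move=> x nx; exact: periodize_fun_out.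
Qed.

Lemma oaut_span_fix_lt c x : h c = c -> c < s -> oaut_span x -> c < x.
Proof.
move=> hc cs [k [y [sy yh ->]]].
rewrite -[X in X < _](oexpz_fix k hc).
by rewrite oaut_lt (lt_le_trans cs).
Qed.

Lemma oaut_span_fix_gt c x : h c = c -> s < c -> oaut_span x -> x < c.
Proof.
move=> hc sc [k [y [sy yh ->]]].
rewrite -[X in _ < X](oexpz_fix k hc).
by rewrite oaut_lt (lt_le_trans yh) // -hc oaut_le ltW.
Qed.

(** Otherwise the increasing orbit of [s] is bounded by [x], and its limit is a fixed point in
    [s, x]. *)
Lemma oaut_span_ge x : s <= x -> (forall t, s <= t <= x -> h t <> t) -> oaut_span x.
Proof.
move=> sx nf; apply/oaut_spanP; exists 0.
have [|hn] := pselect (exists n, x < (h ^+ n)%g s).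
  by move=> [n xn]; exists n%:Z.
have [n|c [sc cx]] := @oaut_orbit_ub h s x (ltW hs).
  by rewrite leNgt; apply/negP => xn; apply: hn; exists n.
by move/nf; rewrite sc cx => /(_ isT).
Qed.

Lemma oaut_span_le x : x <= s -> (forall t, x <= t <= s -> h t <> t) -> oaut_span x.
Proof.
move=> xs nf; apply/oaut_spanP.
have [|hn] := pselect (exists n, (h ^- n)%g s <= x).
  move=> [[|n] xn]; first by exists 0, 1; split=> //; exact: le_lt_trans hs.
  by exists (Negz n), 1; split=> //; exact: le_lt_trans hs.
have [|n|c [xc cs]] := @oaut_orbit_lb h^-1%g s x.
- by rewrite oaut_leV ltW.
- rewrite leNgt; apply/negP => xn; apply: hn; exists n.
  by rewrite -expVgn ltW.
by move=> /oautE_V /esym/nf; rewrite xc cs => /(_ isT).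
Qed.

(** The powers of [h] carry the commutation from one fundamental domain to all its translates. *)
Lemma oaut_span_commute (p q : oaut) : commute h p -> commute h q ->
  (forall y, s <= y -> y < h s -> p (q y) = q (p y)) ->
  forall x, oaut_span x -> p (q x) = q (p x).
Proof.
move=> hp hq pq x [k [y [sy yh ->]]].
have cz (g : oaut) : commute h g -> commute (oexpz h k) g.
  by move=> hg; apply: commute_sym; case: k => n /=;
    [|apply: commuteV]; apply: commuteX; apply: commute_sym.
have E (g : oaut) u : commute h g -> g (oexpz h k u) = oexpz h k (g u).
  by move=> /cz hg; rewrite -!oautM hg.
by rewrite !E ?pq.
Qed.

End Periodize.

End OrderAut.

(** * Order automorphisms of the line as homeomorphisms of the interval *)

Section Embedding.
Variable R : realType.
Local Open Scope ring_scope.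
Implicit Types f g : oaut R.

(** The preimage of an open interval is the open interval between the preimages of its ends. *)
Lemma oaut_continuous f : continuous f.
Proof.
move=> x; apply/cvgrPdist_lt => e e0.
have : \forall y \near x, y \in `](f^-1)%g (f x - e), (f^-1)%g (f x + e)[%R.
  by apply: near_in_itvoo; rewrite in_itv /= oaut_ltV oaut_ltV_r; lra.
apply: filterS => y; rewrite in_itv /= oaut_ltV oaut_ltV_r => /andP[y1 y2].
by rewrite ltr_norml; lra.
Qed.

Lemma unitIP (x : unitI R) : 0 <= set_val x <= 1.
Proof. by have := set_valP x; rewrite set_valE /= in_itv. Qed.

Lemma unitI_subproof t : 0 <= t <= 1 -> t \in (`[0, 1] : set R)%classic.
Proof. by move=> h; rewrite inE /= in_itv. Qed.

Definition to_unitI t (h : 0 <= t <= 1) : unitI R := SigSub (unitI_subproof h).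

Lemma to_unitIK t (h : 0 <= t <= 1) : set_val (to_unitI h) = t.
Proof. by rewrite set_valE. Qed.

Lemma set_val_inj : injective (set_val : unitI R -> R).
Proof. by move=> x y; rewrite set_valE; exact: val_inj. Qed.

Section Restrict.
Variable f : oaut R.
Hypotheses (f0 : f 0 = 0) (f1 : f 1 = 1).

Let stable t : 0 <= t <= 1 -> 0 <= f t <= 1.
Proof. by rewrite -[X in _ -> X <= _ <= _]f0 -[X in _ -> _ <= _ <= X]f1 !oaut_le. Qed.

Definition restrict_fun (x : unitI R) : unitI R := to_unitI (stable (unitIP x)).

Lemma restrict_funE x : set_val (restrict_fun x) = f (set_val x).
Proof. exact: to_unitIK. Qed.

Lemma restrict_fun_continuous : continuous restrict_fun.
Proof.
apply: continuous_comp_initial => x.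
rewrite [X in continuous_at _ X](_ : _ = f \o (set_val : unitI R -> R)); last first.
  by apply/funext => y; exact: restrict_funE.
apply: continuous_comp; last exact: oaut_continuous.
exact: initial_continuous.
Qed.

End Restrict.

Lemma restrict_funK f (f0 : f 0 = 0) (f1 : f 1 = 1) g (g0 : g 0 = 0) (g1 : g 1 = 1) :
  cancel f g -> cancel (restrict_fun f0 f1) (restrict_fun g0 g1).
Proof. by move=> fK x; apply: set_val_inj; rewrite !restrict_funE fK. Qed.

Lemma restrict_fun_incr f (f0 : f 0 = 0) (f1 : f 1 = 1) (x y : unitI R) :
  set_val x < set_val y ->
  set_val (restrict_fun f0 f1 x) < set_val (restrict_fun f0 f1 y).
Proof. by rewrite !restrict_funE oaut_lt. Qed.

Definition restrict f (f0 : f 0 = 0) (f1 : f 1 = 1) : homeoI R :=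
  let v0 := oaut_fixV f0 in let v1 := oaut_fixV f1 in
  HomeoI (restrict_funK f0 f1 v0 v1 (oautK f)) (restrict_funK v0 v1 f0 f1 (oautVK f))
    (@restrict_fun_continuous f f0 f1) (@restrict_fun_continuous _ v0 v1)
    (restrict_fun_incr f0 f1).

Lemma restrictE f (f0 : f 0 = 0) (f1 : f 1 = 1) x :
  set_val (restrict f0 f1 x) = f (set_val x).
Proof. exact: restrict_funE. Qed.

(** * Transport from the line to the unit interval through an arctangent chart *)

Definition chart (t : R) : R := atan t / pi + 2^-1.
Definition unchart (u : R) : R := tan (pi * (u - 2^-1)).

Lemma chart_itv t : 0 < chart t < 1.
Proof.
have p0 : 0 < pi :> R := pi_gt0 R.
have := atan_gtNpi2 t; have := atan_ltpi2 t => a1 a2.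
rewrite /chart; apply/andP; split.
  by rewrite -ltrBlDr sub0r ltr_pdivlMr //; lra.
by rewrite -ltrBrDr ltr_pdivrMr //; lra.
Qed.

Lemma chartK : cancel chart unchart.
Proof.
move=> t; rewrite /unchart /chart addrK mulrC divfK ?gt_eqF ?pi_gt0 //.
exact: atanK.
Qed.

Lemma unchartK u : 0 < u < 1 -> chart (unchart u) = u.
Proof.
move=> /andP[u0 u1]; have p0 : 0 < pi :> R := pi_gt0 R.
rewrite /unchart /chart tanK; last by rewrite in_itv /=; apply/andP; split; nra.
by rewrite [pi * _]mulrC mulfK ?gt_eqF // subrK.
Qed.

Lemma chart_lt x y : (chart x < chart y) = (x < y).
Proof.
rewrite /chart ltrD2r ltr_pM2r ?invr_gt0 ?pi_gt0 //.
exact: (leW_mono (le_mono (@lt_atan R))).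
Qed.

(** Conjugate of [f] by the chart, completed by the identity outside ]0, 1[. The result is again an
    increasing bijection of the line, and it fixes 0 and 1. *)
Definition squeeze_fun (f : R -> R) u : R :=
  if 0 < u < 1 then chart (f (unchart u)) else u.

Lemma squeeze_funE f t : squeeze_fun f (chart t) = chart (f t).
Proof. by rewrite /squeeze_fun chart_itv chartK. Qed.

Lemma squeeze_funK f g : cancel f g -> cancel (squeeze_fun f) (squeeze_fun g).
Proof.
move=> fK u; rewrite [squeeze_fun f u]/squeeze_fun.
have [h|/negbTE h] := boolP (0 < u < 1); last by rewrite /squeeze_fun h.
by rewrite squeeze_funE fK unchartK.
Qed.

Lemma squeeze_fun_mono f : {homo squeeze_fun f : x y / x < y}.
Proof.
move=> x y xy; rewrite /squeeze_fun.
have [hx|hx] := boolP (0 < x < 1); have [hy|hy] := boolP (0 < y < 1) => //.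
- by rewrite chart_lt oaut_lt -chart_lt !unchartK.
- by have /andP[_ ] := chart_itv (f (unchart x)); lra.
- by have /andP[] := chart_itv (f (unchart y)); lra.
Qed.

Definition squeeze f : oaut R :=
  OAut (squeeze_funK (oautK f)) (squeeze_funK (oautVK f)) (@squeeze_fun_mono f).

Lemma squeeze0 f : squeeze f 0 = 0.
Proof. by rewrite /= /squeeze_fun ltxx. Qed.

Lemma squeeze1 f : squeeze f 1 = 1.
Proof. by rewrite /= /squeeze_fun ltxx andbF. Qed.

Definition homeo_of f : homeoI R := restrict (squeeze0 f) (squeeze1 f).

Lemma homeo_ofE f x : set_val (homeo_of f x) = squeeze f (set_val x).
Proof. exact: restrictE. Qed.

Let homeo_ofM : {morph homeo_of : f g / (f * g)%g}.
Proof.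
move=> f g; apply: homeoI_eq => x; apply: set_val_inj.
rewrite [RHS]/= !homeo_ofE /= /squeeze_fun.
have [h|/negbTE h] := boolP (0 < set_val x < 1); last by rewrite h.
by rewrite chart_itv chartK.
Qed.

Let homeo_ofF : {morph homeo_of : f g / (f / g)%g}.
Proof. by move=> f g; apply: (mulIg (homeo_of g)); rewrite mulgVK -homeo_ofM mulgVK. Qed.

HB.instance Definition _ := isGroupMorphism.Build (oaut R) (homeoI R) homeo_of
  homeo_ofF.

Lemma chart_le01 t : 0 <= chart t <= 1.
Proof. by have := chart_itv t; lra. Qed.

Lemma homeo_of_chart f t : set_val (homeo_of f (to_unitI (chart_le01 t))) = chart (f t).
Proof. by rewrite homeo_ofE to_unitIK /= squeeze_funE. Qed.

Lemma homeo_of_inj : injective homeo_of.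
Proof.
move=> f g fg; apply: oaut_eq => t.
by apply: (can_inj chartK); rewrite -!homeo_of_chart fg.
Qed.

Lemma supp_homeo_of f :
  supp (homeo_of f) = [set chart t | t in [set t | f t <> t]]%classic.
Proof.
apply/seteqP; split=> u /=.
- move=> [x hx <-]; have h : 0 < set_val x < 1.
    apply/negPn/negP => h; apply: hx; apply: set_val_inj.
    by rewrite homeo_ofE /= /squeeze_fun (negbTE h).
  exists (unchart (set_val x)); last by rewrite unchartK.
  move=> e; apply: hx; apply: set_val_inj.
  by rewrite homeo_ofE /= /squeeze_fun h e unchartK.
- move=> [t ft <-]; exists (to_unitI (chart_le01 t)); last by rewrite to_unitIK.
  move=> e; apply: ft; apply: (can_inj chartK).
  by rewrite -homeo_of_chart e to_unitIK.
Qed.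

Lemma chart_image_gt a : [set chart t | t in [set t | a < t]]%classic = `]chart a, 1[%classic.
Proof.
apply/seteqP; split=> u /=; rewrite in_itv /=.
  by move=> [t at_ <-]; rewrite chart_lt at_; case/andP: (chart_itv t).
move=> /andP[au u1]; have h : 0 < u < 1 by have := chart_itv a; lra.
exists (unchart u); last by rewrite unchartK.
by rewrite /= -chart_lt unchartK.
Qed.

Lemma chart_image_lt a : [set chart t | t in [set t | t < a]]%classic = `]0, chart a[%classic.
Proof.
apply/seteqP; split=> u /=; rewrite in_itv /=.
  by move=> [t at_ <-]; rewrite chart_lt at_; case/andP: (chart_itv t) => ->.
move=> /andP[u0 ua]; have h : 0 < u < 1 by have := chart_itv a; lra.
exists (unchart u); last by rewrite unchartK.
by rewrite /= -chart_lt unchartK.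
Qed.

Lemma two_chain_overlap (a b c d : R) :
  a < c -> c < b -> b < d -> two_chain `]c, d[%classic `]a, b[%classic.
Proof.
move=> ac cb bd.
have E : (`]c, d[ `&` `]a, b[)%classic = `]c, b[%classic.
  by apply/seteqP; split=> t /=; rewrite !in_itv /=; [move=> []|]; lra.
have m1 : c < (c + b) / 2 < b by lra.
have m2 : a < (a + c) / 2 < c by lra.
have m3 : b < (b + d) / 2 < d by lra.
split; rewrite ?E.
- split; [exists c, d | exists a, b]; split=> //; first exact: lt_trans bd.
  exact: lt_trans cb.
- split; last exact: interval_is_interval.
  by exists ((c + b) / 2); rewrite /= in_itv.
- split=> [t /=|]; first by rewrite !in_itv /=; lra.
  by move=> /(_ ((b + d) / 2)) /=; rewrite !in_itv /=; lra.
- split=> [t /=|]; first by rewrite !in_itv /=; lra.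
  by move=> /(_ ((a + c) / 2)) /=; rewrite !in_itv /=; lra.
Qed.

(** * Extension of increasing bijections of the unit interval to the line *)

Section Extend.
Variables h k : unitI R -> unitI R.
Hypotheses (hK : cancel h k) (kK : cancel k h).
Hypothesis h_incr : forall x y, set_val x < set_val y -> set_val (h x) < set_val (h y).

(** The default [t] makes this the extension by the identity off [0, 1]. *)
Definition extend_fun (h' : unitI R -> unitI R) t : R :=
  oapp (fun x : unitI R => set_val (h' x)) t (insub t : option (unitI R)).

Lemma extend_funE h' x : extend_fun h' (set_val x) = set_val (h' x).
Proof. by rewrite /extend_fun set_valE /= valK. Qed.

Lemma extend_fun_out h' t : ~~ (0 <= t <= 1) -> extend_fun h' t = t.
Proof.
move=> ht; rewrite /extend_fun insubF //; apply/negbTE; apply: contra ht.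
by rewrite inE /= in_itv.
Qed.

Lemma extend_funK h1 h2 : cancel h1 h2 -> cancel (extend_fun h1) (extend_fun h2).
Proof.
move=> h12 t; have [p|p] := boolP (0 <= t <= 1); last by rewrite !extend_fun_out.
by rewrite -(to_unitIK p) !extend_funE h12.
Qed.

Lemma extend_fun_mono : {homo extend_fun h : x y / x < y}.
Proof.
move=> x y xy; have [p|p] := boolP (0 <= x <= 1); have [q|q] := boolP (0 <= y <= 1).
- by rewrite -(to_unitIK p) -(to_unitIK q) !extend_funE h_incr // !to_unitIK.
- rewrite -(to_unitIK p) !extend_funE (extend_fun_out _ q).
  by have := unitIP (h (to_unitI p)); lra.
- rewrite -(to_unitIK q) !extend_funE (extend_fun_out _ p).
  by have := unitIP (h (to_unitI q)); lra.
- by rewrite !extend_fun_out.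
Qed.

Definition extend : oaut R := OAut (extend_funK hK) (extend_funK kK) extend_fun_mono.

Lemma extendE x : extend (set_val x) = set_val (h x).
Proof. exact: extend_funE. Qed.

End Extend.

End Embedding.

(** * Thompson's group and its normal form *)

Section EvalWord.
Local Open Scope group_scope.
Variables (G : groupType) (a b : G).

Definition eval_letter (l : bool * bool) : G :=
  let g := if l.1 then a else b in if l.2 then g^-1 else g.

Definition eval_word (w : word bool) : G := \prod_(l <- w) eval_letter l.

Lemma eval_word_cat u v : eval_word (u ++ v) = eval_word u * eval_word v.
Proof. exact: big_cat. Qed.

Lemma eval_letter_inv l : eval_letter (letter_inv l) = (eval_letter l)^-1.
Proof. by case: l => [x []]; rewrite /eval_letter /= ?invgK. Qed.

Lemma eval_word_nil : eval_word [::] = 1.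
Proof. exact: big_nil. Qed.

Lemma eval_word_cons l w : eval_word (l :: w) = eval_letter l * eval_word w.
Proof. exact: big_cons. Qed.

Lemma eval_word_inv w : eval_word (word_inv w) = (eval_word w)^-1.
Proof.
elim: w => [|l w IH]; first by rewrite /eval_word /word_inv !big_nil invg1.
rewrite -cat1s word_inv_cat !eval_word_cat IH invgM; congr (_ * _).
by rewrite /word_inv /eval_word !big_seq1 eval_letter_inv.
Qed.

Lemma eval_word_comm u v : eval_word (word_comm u v) = [~ eval_word u, eval_word v].
Proof. by rewrite /word_comm !eval_word_cat !eval_word_inv commgEl conjgE !mulgA. Qed.

Lemma eval_genA : eval_word genA = a.
Proof. exact: big_seq1. Qed.

Lemma eval_genB : eval_word genB = b.
Proof. exact: big_seq1. Qed.

Lemma eval_genAB : eval_word genAB = a * b.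
Proof. by rewrite eval_word_cat eval_genA eval_genB. Qed.

Lemma eval_pres_eq rels : (forall r, r \in rels -> eval_word r = 1) ->
  forall u v, pres_eq rels u v -> eval_word u = eval_word v.
Proof.
move=> relsP u v; elim=> {u v} // [u v w _ -> _ -> //|u l v|u r v rr].
  rewrite !eval_word_cat !eval_word_cons eval_letter_inv.
  by rewrite eval_word_nil mulg1 mulgV mul1g.
by rewrite !eval_word_cat (relsP r) ?mul1g.
Qed.

End EvalWord.

(** * The normal form in a group satisfying the two relations *)

Section ThompsonNormalForm.
Local Open Scope group_scope.
Variables (G : groupType) (a b : G).

(** The generators of the infinite presentation of [F], with relations [X n * X k = X k * X n.+1]
    for [k < n]. Here [a * b] plays the role of the generator of index 0 and [b] of that of index
    1. *)
Definition thompson_gen (n : nat) : G :=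
  if n is m.+1 then (a * b) ^- m * b * (a * b) ^+ m else a * b.
Local Notation X := thompson_gen.

Definition thompson_mon (s : seq nat) : G := \prod_(i <- s) X i.

Lemma thompson_genS n : X n.+2 = (a * b)^-1 * X n.+1 * (a * b).
Proof. by rewrite /thompson_gen expgSr invgM !mulgA. Qed.

Lemma eval_thompson_relsE :
  map (eval_word a b) thompson_rels = [:: [~ a, X 2]; [~ a, X 3]].
Proof.
congr [:: _; _];
  rewrite eval_word_comm !eval_word_cat !eval_word_inv eval_genAB !eval_genA !eval_genB.
- by rewrite /thompson_gen expg1 mulgA.
- by rewrite /thompson_gen expg2 [in RHS](invgM (a * b) (a * b)) !mulgA.
Qed.

Lemma eval_thompson_rels :
  (forall r, r \in thompson_rels -> eval_word a b r = 1) <->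
  commute a (X 2) /\ commute a (X 3).
Proof.
have E : (forall r, r \in thompson_rels -> eval_word a b r = 1) <->
    all (eq_op^~ 1) (map (eval_word a b) thompson_rels).
  split=> [h|/allP h r rr]; last by apply/eqP/h/map_f.
  by apply/allP => _ /mapP[r /h -> ->].
rewrite E eval_thompson_relsE /= andbT.
by split=> [/andP[/commgP ? /commgP ?] //|[/commgP -> /commgP ->]].
Qed.

Hypotheses (c2 : commute a (X 2)) (c3 : commute a (X 3)).

Lemma thompson_gen_conj n k : X (n.+1 + k) = (a * b) ^- k * X n.+1 * (a * b) ^+ k.
Proof.
elim: k => [|k IH]; first by rewrite addn0 expg0 invg1 mul1g mulg1.
by rewrite addnS addSn thompson_genS -addSn IH expgSr (invgM (_ ^+ _)) !mulgA.
Qed.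

(** As [X 1] is [a^-1 * X 0], its conjugation action on an element commuting with [a] is that of
    [X 0], which shifts the index. *)
Lemma thompson_gen_rel1_of n : commute a (X n.+2) -> X n.+2 * X 1 = X 1 * X n.+3.
Proof.
move=> cn; rewrite [X n.+3]thompson_genS.
have -> : X 1 = a^-1 * (a * b) by rewrite mulKg /= expg0 invg1 mul1g mulg1.
have cn' : commute a^-1 (X n.+2) by apply: commute_sym; apply: commuteV; exact: commute_sym.
move: (a * b) (X n.+2) cn' => h y ay.
by rewrite mulgA -ay -!mulgA mulVKg.
Qed.

(** Conjugation by [(a * b) ^+ k] shifts all positive indices by [k]. *)
Lemma thompson_gen_conj_rel n k :
  X n.+2 * X 1 = X 1 * X n.+3 -> X (n.+2 + k) * X k.+1 = X k.+1 * X (n.+3 + k).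
Proof.
move=> E; rewrite -(add1n k).
rewrite (thompson_gen_conj n.+1) (thompson_gen_conj 0) (thompson_gen_conj n.+2).
move: (X n.+2) (X n.+3) (X 1) ((a * b) ^+ k) E => x y z h E.
by rewrite -!mulgA !mulVKg [x * (z * h)]mulgA E !mulgA.
Qed.

(** Two relations yield all of them: [X n.+4] is the conjugate of [X n.+3] by [X n.+2], so two
    consecutive cases are carried through the induction. *)
Lemma thompson_gen_commute n : commute a (X n.+2).
Proof.
suff [] : commute a (X n.+2) /\ commute a (X n.+3) by [].
elim: n => [//|n [IH1 IH2]]; split=> //.
have := thompson_gen_conj_rel n.+1 (thompson_gen_rel1_of c2).
rewrite add2n => E.
have -> : X n.+4 = (X n.+2)^-1 * X n.+3 * X n.+2.
  by rewrite -mulgA E mulKg -addn3 addnC.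
by apply: commuteM => //; apply: commuteM => //; apply: commuteV.
Qed.

Lemma thompson_gen_rel k n : (k < n)%N -> X n * X k = X k * X n.+1.
Proof.
case: n k => [|n] [|k] //; first by move=> _; rewrite thompson_genS !mulgA mulgV mul1g.
rewrite ltnS => kn.
have := thompson_gen_conj_rel k (thompson_gen_rel1_of (thompson_gen_commute (n - k.+1))).
have -> : ((n - k.+1).+3 + k = n.+2)%N by lia.
by have -> : ((n - k.+1).+2 + k = n.+1)%N by lia.
Qed.

Lemma thompson_mon_cons i s : thompson_mon (i :: s) = X i * thompson_mon s.
Proof. exact: big_cons. Qed.

Lemma thompson_mon_cat s t : thompson_mon (s ++ t) = thompson_mon s * thompson_mon t.
Proof. exact: big_cat. Qed.

(** Insertion sort in which [X j] becomes [X j.+1] when it passes a smaller [X i]. The lower bound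
    [m] ensures that the head stays minimal. *)
Lemma thompson_mon_insert s j m : sorted leq s -> all (leq m) s -> (m <= j)%N ->
  exists s', [/\ sorted leq s', all (leq m) s' & X j * thompson_mon s = thompson_mon s'].
Proof.
elim: s j m => [|i s IH] j m sS mS mj.
  by exists [:: j]; rewrite /= mj thompson_mon_cons.
have [ji|ij] := leqP j i.
  exists [:: j, i & s]; split; [by rewrite /= ji | by rewrite /= mj | ].
  by rewrite [RHS]thompson_mon_cons.
have /= := sS; rewrite (path_sortedE leq_trans) => /andP[iS sS'].
have [s' [sS'' iS' E]] := IH j.+1 i sS' iS (leqW (ltnW ij)).
case/andP: mS => mi _; exists (i :: s'); split.
- by rewrite /= (path_sortedE leq_trans) iS'.
- by rewrite /= mi; apply: sub_all iS' => x; exact: leq_trans.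
- by rewrite !thompson_mon_cons mulgA thompson_gen_rel // -mulgA E.
Qed.

Lemma thompson_mon_sort s : exists2 s', sorted leq s' & thompson_mon s = thompson_mon s'.
Proof.
elim: s => [|i s [s' sS E]]; first by exists [::].
have [|t [tS _ E']] := @thompson_mon_insert s' i 0 sS _ (leq0n _).
  by apply/allP.
by exists t; rewrite // thompson_mon_cons E.
Qed.

(** An inverse generator moves to the right past a positive one: the larger of the two indices goes
    up by one, and equal indices cancel. *)
Lemma thompson_mon_invl j s : exists s' t,
  (X j)^-1 * thompson_mon s = thompson_mon s' * (thompson_mon t)^-1.
Proof.
elim: s j => [|i s IH] j.
  by exists [::], [:: j]; rewrite /thompson_mon big_nil big_seq1 mulg1 mul1g.
rewrite thompson_mon_cons mulgA; case: (ltngtP i j) => [ij|ji|->].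
- have -> : (X j)^-1 * X i = X i * (X j.+1)^-1.
    apply: (mulgI (X j)); apply: (mulIg (X j.+1)).
    by rewrite mulVKg -[RHS]mulgA mulgVK (thompson_gen_rel ij).
  have [s' [t E]] := IH j.+1; exists (i :: s'), t.
  by rewrite -mulgA E thompson_mon_cons mulgA.
- have -> : (X j)^-1 * X i = X i.+1 * (X j)^-1.
    apply: (mulgI (X j)); apply: (mulIg (X j)).
    by rewrite mulVKg -[RHS]mulgA mulgVK (thompson_gen_rel ji).
  have [s' [t E]] := IH j; exists (i.+1 :: s'), t.
  by rewrite -mulgA E thompson_mon_cons mulgA.
- by exists s, [::]; rewrite mulVg mul1g /thompson_mon big_nil invg1 mulg1.
Qed.

Lemma thompson_normal_form w : exists s t,
  [/\ sorted leq s, sorted leq t & eval_word a b w = thompson_mon s * (thompson_mon t)^-1].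
Proof.
suff [s [t E]] : exists s t, eval_word a b w = thompson_mon s * (thompson_mon t)^-1.
  have [s' sS Es] := thompson_mon_sort s; have [t' tS Et] := thompson_mon_sort t.
  by exists s', t'; rewrite -Es -Et.
have pos j g : (exists s t, g = thompson_mon s * (thompson_mon t)^-1) ->
    exists s t, X j * g = thompson_mon s * (thompson_mon t)^-1.
  by move=> [s [t ->]]; exists (j :: s), t; rewrite thompson_mon_cons mulgA.
have neg j g : (exists s t, g = thompson_mon s * (thompson_mon t)^-1) ->
    exists s t, (X j)^-1 * g = thompson_mon s * (thompson_mon t)^-1.
  move=> [s [t ->]]; have [s' [t' E]] := thompson_mon_invl j s.
  by exists s', (t ++ t'); rewrite mulgA E thompson_mon_cat invgM mulgA.
(* The original letters are expressed as [b = X 1] and [a = X 0 * (X 1)^-1], so prefixing a letter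
   amounts to prefixing generators [X j] and their inverses. *)
have X1 : X 1 = b by rewrite /= expg0 invg1 mul1g mulg1.
have X0 g : a * g = X 0 * ((X 1)^-1 * g) by rewrite X1 /= -mulgA mulVKg.
have X0V g : a^-1 * g = X 1 * ((X 0)^-1 * g) by rewrite X1 /= invgM mulgA mulVKg.
elim: w => [|[x e] w IH].
  by exists [::], [::]; rewrite /thompson_mon /eval_word !big_nil invg1 mulg1.
rewrite eval_word_cons /eval_letter /=; case: x; case: e.
- by rewrite X0V; apply: pos; exact: neg.
- by rewrite X0; apply: pos; exact: neg.
- by have := neg 1%N _ IH; rewrite X1.
- by have := pos 1%N _ IH; rewrite X1.
Qed.

End ThompsonNormalForm.

(** * Faithfulness of the action on the line *)

Section ThompsonAction.
Variable R : realType.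
Variables (A B : oaut R) (e : R).
Local Open Scope ring_scope.
Local Notation X := (thompson_gen A B).
Hypotheses (A_ge : forall t, t <= A t) (B_ge : forall t, t <= B t).
Hypotheses (A_e : e < A e) (B_e : forall t, e <= t -> B t = t).
Hypothesis B_lt : ((A * B)^-1)%g e < B (((A * B)^-1)%g e).

Let x0_ge t : t <= X 0 t.
Proof. by apply: le_trans (A_ge _); exact: B_ge. Qed.

Let x0X_ge n t : t <= ((A * B) ^+ n)%g t.
Proof. by elim: n => // n IH; rewrite oaut_expS; exact: le_trans (x0_ge _). Qed.

Lemma thompson_gen_apply n t :
  X n.+1 t = ((A * B) ^- n)%g (B (((A * B) ^+ n)%g t)).
Proof. by []. Qed.

Lemma thompson_gen_ge n t : t <= X n t.
Proof. by case: n => [|n]; [exact: x0_ge | rewrite thompson_gen_apply oaut_leV_r]. Qed.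

Lemma thompson_mon_ge s t : t <= thompson_mon A B s t.
Proof.
elim: s => [|i s IH]; first by rewrite /thompson_mon big_nil.
by rewrite thompson_mon_cons oautM; apply: le_trans (thompson_gen_ge _ _).
Qed.

(** Test points for reading off the normal form: [X n] moves [y n] to the right and fixes [y m] for
    [m < n]. *)
Let y n : R := ((A * B) ^- n)%g e.

(** A non-negative power of [A * B] maps [e] to a point at or beyond [e], where [B] is the
    identity. *)
Lemma thompson_gen_out n m : (m < n)%N -> X n (y m) = y m.
Proof.
case: n => // n; rewrite ltnS => mn; rewrite thompson_gen_apply; apply/oautE_V.
rewrite -(subnK mn) expgnDr /y !oautM oautVK B_e //.
Qed.

Lemma thompson_gen_move m : y m < X m (y m).
Proof.
case: m => [|m]; first by rewrite /y expg0 invg1 oaut1 oautM B_e.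
rewrite thompson_gen_apply oaut_ltV_r /y expgS (invgM (A * B)%g) oautM oautVK.
exact: B_lt.
Qed.

Lemma thompson_mon_out s m : all (leq m.+1) s -> thompson_mon A B s (y m) = y m.
Proof.
elim: s => [|i s IH] /=; first by rewrite /thompson_mon big_nil.
by move=> /andP[mi ms]; rewrite thompson_mon_cons oautM IH // thompson_gen_out.
Qed.

(** If the first indices differ, the smaller one, [i], gives a contradiction at [y i]: the monomial
    starting with [X i] moves it, because no generator pushes to the left, while all generators of
    the other monomial fix it. Equal first letters cancel. *)
Lemma thompson_mon_inj s t : sorted leq s -> sorted leq t ->
  thompson_mon A B s = thompson_mon A B t -> s = t.
Proof.
have sorted_gt i j (u : seq nat) : (i < j)%N -> sorted leq (j :: u) -> all (leq i.+1) (j :: u).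
  move=> ij; rewrite /= (path_sortedE leq_trans) ij => /andP[ju _] /=.
  by apply: sub_all ju => k; exact: leq_trans.
have no i u v : all (leq i.+1) v -> thompson_mon A B (i :: u) <> thompson_mon A B v.
  move=> iv /(congr1 (fun g : oaut R => g (y i))).
  rewrite thompson_mon_cons oautM (thompson_mon_out iv) => E.
  have := thompson_gen_move i; rewrite -[X in _ < X]/(X i (y i)) -[X in X < _]E.
  by rewrite oaut_lt ltNge thompson_mon_ge.
elim: s t => [|i s IH] [|j t] sS tS E //.
- by case: (@no j t [::]) => //.
- by case: (@no i s [::]) => //.
- case: (ltngtP i j) => [ij|ji|ij].
  + by case: (@no i s (j :: t)) => //; exact: sorted_gt.
  + by case: (@no j t (i :: s)) => //; exact: sorted_gt.
  + subst j; congr (_ :: _); apply: IH.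
    * exact: path_sorted sS.
    * exact: path_sorted tS.
    * by move: E; rewrite !thompson_mon_cons => /mulgI.
Qed.

(** The normal form is taken in the presented group and pushed to the line by the induced morphism.
    There the positive and the negative part coincide, so they have the same indices and already
    cancel in the presented group. *)
Lemma thompson_eval_faithful (w : word bool) :
  commute A (X 2) -> commute A (X 3) ->
  eval_word A B w = 1%g -> pres_eq thompson_rels w [::].
Proof.
move=> c2 c3 w1.
pose pi (u : word bool) : thompsonF := \pi_(presented thompson_rels)%qT u.
have piM u v : pi (u ++ v) = (pi u * pi v)%g.
  by rewrite /pi -presented_mulE.
have evalE u : eval_word (pi genA) (pi genB) u = pi u.
  elim: u => [|[x b] u IH]; first by rewrite eval_word_nil.
  rewrite eval_word_cons IH -cat1s piM; congr (_ * _)%g.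
  by case: x; case: b => //; [exact: (presented_invE _ genA) | exact: (presented_invE _ genB)].
have relE r : r \in thompson_rels -> eval_word (pi genA) (pi genB) r = 1%g.
  move=> rr; rewrite evalE; apply/presentedP.
  by have := pres_rel [::] [::] rr; rewrite cats0.
have [cT2 cT3] := (eval_thompson_rels _ _).1 relE.
have [s [t [sS tS E]]] := thompson_normal_form cT2 cT3 w.
have lift u v : pres_eq thompson_rels u v -> eval_word A B u = eval_word A B v.
  by apply: eval_pres_eq; apply/eval_thompson_rels.
have rE (g : thompsonF) : pi (repr g) = g by exact: reprK.
pose L (g : thompsonF) : oaut R := eval_word A B (repr g).
have LM : {morph L : g h / (g * h)%g}.
  move=> g h; rewrite /L -eval_word_cat; apply: lift; apply/presentedP.
  by rewrite -/(pi _) -/(pi _) rE piM !rE.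
have LF : {morph L : g h / (g / h)%g}.
  by move=> g h; apply: (mulIg (L h)); rewrite mulgVK -LM mulgVK.
pose Lm : UMagmaMorphism.type _ _ := HB.pack L (isGroupMorphism.Build _ _ L LF).
have LA : Lm (pi genA) = A.
  by rewrite -[RHS](eval_genA A B); apply: lift; exact: repr_pres.
have LB : Lm (pi genB) = B.
  by rewrite -[RHS](eval_genB A B); apply: lift; exact: repr_pres.
have Lgen n : Lm (thompson_gen (pi genA) (pi genB) n) = X n.
  by case: n => [|n]; rewrite !(gmulfM, gmulfV, gmulfXn) LA LB.
have Lmon u : Lm (thompson_mon (pi genA) (pi genB) u) = thompson_mon A B u.
  by rewrite gmulf_prod; apply: eq_bigr => i _.
have Ew : Lm (pi w) = 1%g by rewrite -w1; apply: lift; exact: repr_pres.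
apply/presentedP; rewrite -/(pi w) -(evalE w) E.
suff -> : s = t by rewrite mulgV.
apply: thompson_mon_inj => //; rewrite -!Lmon.
by apply/eqP; rewrite -divg_eq1 -gmulfF -E evalE Ew.
Qed.

Lemma thompson_eval_inj (u v : word bool) :
  commute A (X 2) -> commute A (X 3) ->
  eval_word A B u = eval_word A B v -> pres_eq thompson_rels u v.
Proof.
move=> c2 c3 uv; rewrite -[u]cats0.
apply: (@pres_trans _ _ _ (u ++ word_inv v ++ v)).
  by apply: pres_eq_cat (pres_refl _ _) _; apply/pres_sym/pres_catVw.
rewrite catA -[X in pres_eq _ _ X]cat0s; apply: pres_eq_cat (pres_refl _ _).
by apply: thompson_eval_faithful => //; rewrite eval_word_cat eval_word_inv uv mulgV.
Qed.

Lemma thompson_iso : commute A (X 2) -> commute A (X 3) ->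
  isomorphic (generated [set homeo_of A; homeo_of B]%classic) thompsonF.
Proof.
move=> c2 c3; set a := homeo_of A; set b := homeo_of B.
have evE w : eval_word a b w = homeo_of (eval_word A B w).
  rewrite /eval_word gmulf_prod; apply: eq_bigr => -[x i] _.
  by case: x; case: i => //; rewrite /eval_letter /= gmulfV.
have injw u v : eval_word a b u = eval_word a b v <-> pres_eq thompson_rels u v.
  rewrite !evE; split=> [/homeo_of_inj|uv]; first exact: thompson_eval_inj.
  by congr homeo_of; apply: eval_pres_eq uv; apply/eval_thompson_rels.
have gen w : eval_word a b w \in gen_pred [set a; b]%classic.
  apply/asboolP => H Hc Hab; elim: w => [|[x i] w IH].
    by rewrite eval_word_nil; case: Hc.
  rewrite eval_word_cons; apply: (group_closedM Hc) => //.
  have aH : a \in H by apply: Hab; left.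
  have bH : b \in H by apply: Hab; right.
  by case: x; case: i => //; exact: (group_closedV Hc).
have genP (g : generated [set a; b]%classic) : exists w, eval_word a b w = val g.
  have /asboolP gP := gen_valP g.
  have /asboolP : val g \in [pred x | `[< exists w, eval_word a b w = x >]].
    apply: gP; last first.
      by move=> x [->|->]; apply/asboolP; [exists genA; exact: eval_genA |
        exists genB; exact: eval_genB].
    split; first by apply/asboolP; exists [::]; exact: eval_word_nil.
    move=> g1 g2 /asboolP[u <-] /asboolP[v <-]; apply/asboolP; exists (u ++ word_inv v).
    by rewrite eval_word_cat eval_word_inv.
  by move=> [w <-]; exists w.
(* The isomorphism sends an element to the class of any word representing it; by [injw] the choice
   does not matter. *)
pose wd g := sval (cid (genP g)).
have wdP g : eval_word a b (wd g) = val g by exact: svalP (cid (genP g)).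
pose phi g : thompsonF := \pi_(presented thompson_rels)%qT (wd g).
have phiM : {morph phi : x y / (x * y)%g}.
  move=> g1 g2; have -> : (phi g1 * phi g2)%g = \pi_(presented thompson_rels)%qT (wd g1 ++ wd g2).
    exact: presented_mulE.
  apply/presentedP/injw.
  by rewrite eval_word_cat !wdP valM.
pose m : {multiplicative generated [set a; b]%classic -> thompsonF} :=
  HB.pack phi (isMultiplicative.Build _ _ phi phiM).
exists m; exists (fun g => Generated (gen (repr g))).
- move=> g; apply: val_inj; rewrite -[RHS]wdP; apply/injw; exact: repr_pres.
- move=> g; rewrite -[RHS]reprK; apply/presentedP/injw; exact: wdP.
Qed.

End ThompsonAction.

(** * A conjugator commuting with prescribed powers *)

(** Conjugating [v^-1 * n * v * n^-1] by [v] gives [n * v * n^-1 * v^-1], which is its inverse as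
    soon as [v] and [v^-1] conjugate [n] to the same element. It is used for [v] and then for
    [r ^+ 2]. *)
Lemma commg_reverses (G : groupType) (v n : G) : commute n (v ^+ 2)%g ->
  (v * [~ v, n^-1] = [~ v, n^-1]^-1 * v)%g.
Proof.
move=> nv; have nv' : (n^-1 * (v * v) = v * v * n^-1)%g.
  by apply/esym/commuteV; rewrite -expg2; exact: commute_sym.
rewrite commgEl conjgE mulVKg !invgM !invgK -!mulgA nv'.
by rewrite -!mulgA mulKg.
Qed.

(** * Explicit piecewise linear generators and bumps *)

Section Bump.
Variable R : realType.
Local Open Scope ring_scope.

(** Square roots of the generators of [F]. The slopes and translations are chosen so that [A] is
    translation by 2 on [1, +oo[ and multiplication by 4 on [0, 1/2], and [B] is translation by 1 on
    ]-oo, 3/2]; in particular [A * B] maps 0 to 3. *)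
Definition pushR_fun (t : R) : R :=
  if t <= 0 then t else if t <= 1 then 2 * t else t + 1.
Definition pushR_inv (t : R) : R :=
  if t <= 0 then t else if t <= 2 then t / 2 else t - 1.
Definition pushL_fun (t : R) : R :=
  if t <= 2 then t + 2^-1 else if t <= 3 then (t + 3) / 2 else t.
Definition pushL_inv (t : R) : R :=
  if t <= 5 / 2 then t - 2^-1 else if t <= 3 then 2 * t - 3 else t.

(** A comparison is split only when its left side contains no conditional, so inner pieces are
    resolved before outer ones. *)
Ltac pieces := rewrite /pushR_fun /pushR_inv /pushL_fun /pushL_inv;
  repeat match goal with |- context [if (?a <= ?b) then _ else _] =>
    lazymatch a with
    | context [if _ then _ else _] => fail
    | _ => let h := fresh "h" in case: (leP a b) => h
    end
  end; lra.

Lemma pushR_funK : cancel pushR_fun pushR_inv.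
Proof. move=> t; pieces. Qed.
Lemma pushR_invK : cancel pushR_inv pushR_fun.
Proof. move=> t; pieces. Qed.
Lemma pushR_mono : {homo pushR_fun : x y / x < y}.
Proof. move=> x y xy; pieces. Qed.
Lemma pushL_funK : cancel pushL_fun pushL_inv.
Proof. move=> t; pieces. Qed.
Lemma pushL_invK : cancel pushL_inv pushL_fun.
Proof. move=> t; pieces. Qed.
Lemma pushL_mono : {homo pushL_fun : x y / x < y}.
Proof. move=> x y xy; pieces. Qed.

Definition pushR : oaut R := OAut pushR_funK pushR_invK pushR_mono.
Definition pushL : oaut R := OAut pushL_funK pushL_invK pushL_mono.

Local Notation A := (pushR ^+ 2)%g.
Local Notation B := (pushL ^+ 2)%g.

Lemma pushR_fix t : t <= 0 -> pushR t = t.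
Proof. by rewrite /= /pushR_fun => ->. Qed.
Lemma pushR_gt t : 0 < t -> t < pushR t.
Proof. rewrite /=; move=> *; pieces. Qed.
Lemma pushR_shift t : 1 <= t -> pushR t = t + 1.
Proof. rewrite /=; move=> *; pieces. Qed.
Lemma pushL_fix t : 3 <= t -> pushL t = t.
Proof. rewrite /=; move=> *; pieces. Qed.
Lemma pushL_gt t : t < 3 -> t < pushL t.
Proof. rewrite /=; move=> *; pieces. Qed.

Lemma pushR2_fix t : t <= 0 -> A t = t.
Proof. by move=> t0; rewrite expg2 oautM !pushR_fix. Qed.
Lemma pushR2_gt t : 0 < t -> t < A t.
Proof.
move=> t0; have h := pushR_gt t0; rewrite expg2 oautM.
by apply: lt_trans h _; apply: pushR_gt; exact: lt_trans (pushR_gt t0).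
Qed.
Lemma pushR2_ge t : t <= A t.
Proof. by case: (leP t 0) => [/pushR2_fix ->//|/pushR2_gt/ltW]. Qed.
Lemma pushR2_shift t : 1 <= t -> A t = t + 2.
Proof. by move=> t1; rewrite expg2 oautM !pushR_shift //; lra. Qed.
Lemma pushR2_scale t : 0 <= t -> t <= 2^-1 -> A t = 4 * t.
Proof. move=> *; rewrite expg2 oautM /=; pieces. Qed.
Lemma pushL2_fix t : 3 <= t -> B t = t.
Proof. by move=> t0; rewrite expg2 oautM !pushL_fix. Qed.
Lemma pushL2_gt t : t < 3 -> t < B t.
Proof.
move=> t0; rewrite expg2 oautM; apply: lt_trans (pushL_gt t0) _.
by apply: pushL_gt; rewrite -[X in _ < X](pushL_fix (lexx 3)) oaut_lt.
Qed.
Lemma pushL2_ge t : t <= B t.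
Proof. by case: (leP 3 t) => [/pushL2_fix ->//|/pushL2_gt/ltW]. Qed.
Lemma pushL2_shift t : t <= 3 / 2 -> B t = t + 1.
Proof. move=> *; rewrite expg2 oautM /=; pieces. Qed.

Lemma push_corner : ((A * B)^-1)%g 3 = 0.
Proof.
by apply/oautE_V; rewrite oautM pushL2_shift ?pushR2_shift; lra.
Qed.

(** A commutator of [A] and [B]: to the left of 0 the map [A] disappears and [B] cancels; to the
    right of 3 the map [B] disappears and [A] cancels. *)
Definition bump03 : oaut R := (B * A^-1 * B^-1 * A)%g.

Lemma bump03E t : bump03 t = B ((A^-1)%g ((B^-1)%g (A t))).
Proof. by []. Qed.

Lemma bump03_left t : t <= 0 -> bump03 t = t.
Proof.
move=> t0; rewrite bump03E pushR2_fix //.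
by rewrite (oaut_fixV (pushR2_fix _)) ?oautVK // oaut_leV (le_trans t0) // pushL2_shift; lra.
Qed.

Lemma bump03_right t : 3 <= t -> bump03 t = t.
Proof.
move=> t3; have h := pushR2_ge t.
by rewrite bump03E (oaut_fixV (pushL2_fix _)) ?oautK ?pushL2_fix //; lra.
Qed.

Lemma bump03_gt t : 0 < t -> t < 3 -> t < bump03 t.
Proof.
move=> t0 t3; rewrite bump03E; have [t1|t1] := leP 1 t.
  rewrite (oaut_fixV (pushL2_fix _)) ?oautK; first exact: pushL2_gt.
  by rewrite pushR2_shift; lra.
(* For [t < 1] the point [B^-1 t] is at most 0, hence fixed by [A], and the claim reduces to
   [t < A t]. *)
rewrite -oaut_ltV oaut_ltV_r.
rewrite pushR2_fix; first by rewrite oaut_lt; exact: pushR2_gt.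
by rewrite oaut_leV pushL2_shift; lra.
Qed.

Section Affine.
Variables (k c : R).
Hypothesis k0 : 0 < k.
Let affK : cancel (fun t : R => k * t + c) (fun t => (t - c) / k).
Proof. by move=> t; rewrite addrK mulrC mulKf ?gt_eqF. Qed.
Let aff_K : cancel (fun t : R => (t - c) / k) (fun t => k * t + c).
Proof. by move=> t; rewrite mulrC divfK ?gt_eqF // subrK. Qed.
Let aff_mono : {homo (fun t : R => k * t + c) : x y / x < y}.
Proof. by move=> x y; rewrite ltrD2r ltr_pM2l. Qed.
Definition affine : oaut R := OAut affK aff_K aff_mono.
End Affine.

Definition is_bump (p q : R) (b : oaut R) : Prop :=
  [/\ forall t, t <= p -> b t = t, forall t, q <= t -> b t = t
    & forall t, p < t -> t < q -> t < b t].

Lemma bump03P : is_bump 0 3 bump03.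
Proof. by split; [exact: bump03_left | exact: bump03_right | exact: bump03_gt]. Qed.

(** An affine conjugate of [bump03]. *)
Lemma bump_exists p q : p < q -> exists b, is_bump p q b.
Proof.
move=> pq; have k0 : 0 < (q - p) / 3 by lra.
pose l := affine p k0; have l0 : l 0 = p by rewrite /= mulr0 add0r.
have l3 : l 3 = q by rewrite /= divfK // subrK.
have E t : (l * bump03 * l^-1)%g t = l (bump03 ((l^-1)%g t)) by [].
exists (l * bump03 * l^-1)%g; split=> t; rewrite E.
- by rewrite -l0 -oaut_leV => /bump03_left ->; rewrite oautVK.
- by rewrite -l3 -oaut_leV_r => /bump03_right ->; rewrite oautVK.
- rewrite -l0 -l3 => h1 h2; rewrite -oaut_ltV; apply: bump03_gt.
    by rewrite oaut_ltV_r.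
  by rewrite oaut_ltV.
Qed.

(** * Construction of the conjugator [phi] *)

Section Twist.
Variables (p q : R) (al : oaut R).
Hypotheses (pq : p < q) (alP : is_bump p q al).

Lemma bump_ge (b : oaut R) u v t : is_bump u v b -> t <= b t.
Proof.
move=> [b1 b2 b3]; case: (leP t u) => [/b1 ->//|ut].
by case: (leP v t) => [/b2 ->//|tv]; exact/ltW/b3.
Qed.

Lemma bump_pow_gt (b : oaut R) u v n t : is_bump u v b -> u < t -> t < v -> t < (b ^+ n.+1)%g t.
Proof.
move=> bP ut tv; elim: n => [|n IH]; first by case: bP => _ _; exact.
by rewrite oaut_expS; apply: lt_le_trans IH _; exact: bump_ge bP.
Qed.

Lemma bump_pow_lt (b : oaut R) u v n t : is_bump u v b -> t < v -> (b ^+ n)%g t < v.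
Proof.
move=> [_ bv _] tv; rewrite -[X in _ < X](oaut_fixX n (bv v (lexx v))).
by rewrite oaut_lt.
Qed.

(** A positive power of a bump has no fixed point inside the support, so a single fundamental domain
    generates all of it. *)
Lemma bump_span (b : oaut R) u v n s (bs : s < (b ^+ n.+1)%g s) t : is_bump u v b ->
  u < s -> s < v -> oaut_span (b ^+ n.+1)%g s t <-> u < t /\ t < v.
Proof.
move=> bP us sv; have [bu bv _] := bP.
have fu := oaut_fixX n.+1 (bu u (lexx u)); have fv := oaut_fixX n.+1 (bv v (lexx v)).
split=> [st|[ut tv]].
  by split; [exact: oaut_span_fix_lt st | exact: oaut_span_fix_gt fv sv st].
have nf x : u < x -> x < v -> (b ^+ n.+1)%g x <> x.
  by move=> ux xv e; have := bump_pow_gt n bP ux xv; rewrite e ltxx.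
by have [st|/ltW ts] := leP s t; [apply: oaut_span_ge | apply: oaut_span_le] => // x hx;
  apply: nf; lra.
Qed.

Lemma periodize_bump (b : oaut R) u v n s (phi : oaut R) : is_bump u v b -> u < s -> s < v ->
  phi s = s -> phi ((b ^+ n.+1)%g s) = (b ^+ n.+1)%g s ->
  exists P : oaut R, [/\ commute (b ^+ n.+1)%g P,
    forall t, s <= t -> t <= (b ^+ n.+1)%g s -> P t = phi t,
    forall t, t <= u -> P t = t & forall t, v <= t -> P t = t].
Proof.
move=> bP us sv p1 p2; have bs := bump_pow_gt n bP us sv.
have [P [P1 P2 P3]] := periodize bs p1 p2; exists P; split=> // t ht;
  by apply: P3 => /(bump_span bs t bP us sv)[]; lra.
Qed.

(* On [s, al s] the element [rho] commutes with [tau^4] but not with [tau^2];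
   [phi] acts as [rho] on [s, al s], as a copy of [tau rho] on [al s, al^2 s],
   and commutes with [al^2]. *)
Lemma twist_exists : exists phi : oaut R,
  let r := [~ al, phi^-1]%g in let z := [~ r ^+ 2, phi^-1]%g in
  [/\ forall t, t <= p -> phi t = t, forall t, q <= t -> phi t = t,
    commute phi (al ^+ 2)%g, commute phi (r ^+ 4)%g & (z ^+ 2)%g <> 1%g].
Proof.
have [al1 al2 al3] := alP; have pq' := pq.
pose s := (p + q) / 2; have ps : p < s by rewrite /s; lra.
have sq : s < q by rewrite /s; lra.
pose s1 := al s; pose s2 := al s1.
have s1q : s1 < q := bump_pow_lt 1%N alP sq.
have ss1 : s < s1 := al3 s ps sq.
have s12 : s1 < s2 by apply: al3 => //; exact: lt_trans ss1.
have a2s : (al ^+ 2)%g s = s2 by rewrite expg2.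
have [tau tauP] := bump_exists ss1; have [tau1 tau2 tau3] := tauP.
pose u := (s + s1) / 2; have su : s < u by rewrite /u; lra.
have us1 : u < s1 by rewrite /u; lra.
pose u2 := (tau ^+ 2)%g u; pose u4 := (tau ^+ 4)%g u.
have uu2 : u < u2 := bump_pow_gt 1%N tauP su us1.
have u2s1 : u2 < s1 := bump_pow_lt 2%N tauP us1.
have u4E : u4 = (tau ^+ 2)%g u2 by rewrite /u4 /u2 -oautM -expgnDr.
have u24 : u2 < u4 by rewrite u4E; apply: (bump_pow_gt 1%N tauP) => //; exact: lt_trans uu2.
(* [rho] is [ka] on [u, u2], the identity on [u2, u4], and is repeated under [tau ^+ 4]. As
   [tau ^+ 2] maps [u, u2] onto [u2, u4], it cannot commute with [rho]. *)
have [ka kaP] := bump_exists uu2; have [ka1 ka2 ka3] := kaP.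
have [rho [rhoC rhoE rho1 rho2]] :=
  @periodize_bump tau s s1 3%N u ka tauP su us1 (ka1 u (lexx u)) (ka2 _ (ltW u24)).
pose cj (g : oaut R) : oaut R := (al * g * al^-1)%g.
have cjE g t : cj g (al t) = al (g t) by rewrite /cj !oautM oautK.
have cjM g h : cj (g * h)%g = (cj g * cj h)%g by rewrite /cj !mulgA mulgVK.
pose tr := (tau * rho)%g.
have rs : rho s = s by exact: rho1.
have rs1 : rho s1 = s1 by exact: rho2.
have ts : tau s = s by exact: tau1.
have ts1 : tau s1 = s1 by exact: tau2.
pose phi0 := (rho * cj tr)%g.
have cs1 : cj tr s1 = s1 by rewrite cjE /tr oautM rs ts.
have cs2 : cj tr s2 = s2 by rewrite cjE /tr oautM rs1 ts1.
have phi0s : phi0 s = s.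
  rewrite /phi0 oautM -[X in cj tr X](oautVK al) cjE /tr oautM.
  have h : (al^-1)%g s <= s by rewrite oaut_leV ltW.
  by rewrite (rho1 _ h) (tau1 _ h) oautVK.
have phi0s2 : phi0 s2 = s2 by rewrite /phi0 oautM cs2 rho2 // ltW.
have phi0E1 t : s <= t -> t <= s1 -> phi0 t = rho t.
  move=> st ts'; have h : (al^-1)%g t <= s by rewrite oaut_leV.
  by rewrite /phi0 oautM -{1}(oautVK al t) cjE /tr oautM (rho1 _ h) (tau1 _ h) oautVK.
have phi0E2 t : s1 <= t -> t <= s2 -> phi0 t = cj tr t.
  by move=> st ts'; rewrite /phi0 oautM rho2 // -[X in X <= _]cs1 oaut_le.
have phi0s' : phi0 ((al ^+ 2)%g s) = (al ^+ 2)%g s by rewrite a2s.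
have [phi [phiC phiE phi1 phi2]] := @periodize_bump al p q 1%N s phi0 alP ps sq phi0s phi0s'.
exists phi => r z.
have phiE1 t : s <= t -> t <= s1 -> phi t = rho t.
  by move=> h1 h2; rewrite phiE ?phi0E1 // a2s (le_trans h2) ?ltW.
have phiE2 t : s <= t -> t <= s1 -> phi (al t) = al (tr t).
  move=> h1 h2; rewrite -cjE phiE ?phi0E2 ?a2s ?oaut_le //.
  by apply: le_trans (ltW ss1) _; rewrite oaut_le.
have rhoI t : s <= t -> t <= s1 -> s <= rho t /\ rho t <= s1.
  by move=> h1 h2; rewrite -[X in X <= _ /\ _]rs -[X in _ /\ _ <= X]rs1 !oaut_le.
have rhoVI t : s <= t -> t <= s1 -> s <= (rho^-1)%g t /\ (rho^-1)%g t <= s1.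
  by move=> h1 h2; rewrite oaut_leV_r oaut_leV rs rs1.
have tauI t : s <= t -> t <= s1 -> s <= tau t /\ tau t <= s1.
  by move=> h1 h2; rewrite -[X in X <= _ /\ _]ts -[X in _ /\ _ <= X]ts1 !oaut_le.
have tauVI t : s <= t -> t <= s1 -> s <= (tau^-1)%g t /\ (tau^-1)%g t <= s1.
  by move=> h1 h2; rewrite oaut_leV_r oaut_leV ts ts1.
have phiVE1 t : s <= t -> t <= s1 -> (phi^-1)%g t = (rho^-1)%g t.
  by move=> h1 h2; apply/oautE_V; have [h3 h4] := rhoVI t h1 h2; rewrite phiE1 // oautVK.
have phiVE2 t : s <= t -> t <= s1 -> (phi^-1)%g (al t) = al ((tr^-1)%g t).
  move=> h1 h2; apply/oautE_V; have [h3 h4] := tauVI t h1 h2.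
  have [h5 h6] := rhoVI _ h3 h4.
  by rewrite phiE2 /tr invgM ?oautM // !oautVK.
have rE t : r t = (al^-1)%g (phi (al ((phi^-1)%g t))).
  by rewrite /r commgEl conjgE invgK.
(* On [s, s1] the commutator [al^-1 * phi * al * phi^-1] reads [tau * rho * rho^-1]. *)
have rE1 t : s <= t -> t <= s1 -> r t = tau t.
  move=> h1 h2; have [h3 h4] := rhoVI t h1 h2.
  by rewrite rE phiVE1 // phiE2 // oautK /tr oautM oautVK.
have phia2 t : phi (al (al t)) = al (al (phi t)).
  have := congr1 (fun g : oaut R => g t) phiC.
  by rewrite !expg2 !oautM => ->.
(* On [s1, s2] the commutation of [phi] with [al ^+ 2] brings [phi] back to [rho], and
   [rho * (tau * rho)^-1] is [tau^-1]. *)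
have rE2 t : s <= t -> t <= s1 -> r (al t) = al ((tau^-1)%g t).
  move=> h1 h2; have [h3 h4] := tauVI t h1 h2; have [h5 h6] := rhoVI _ h3 h4.
  rewrite rE phiVE2 // phia2 oautK /tr invgM oautM phiE1 // oautVK //.
have rX1 n t : s <= t -> t <= s1 -> (r ^+ n)%g t = (tau ^+ n)%g t /\
    s <= (tau ^+ n)%g t /\ (tau ^+ n)%g t <= s1.
  move=> h1 h2; elim: n => // n [IH [h3 h4]].
  by rewrite !oaut_expS IH rE1 //; split=> //; exact: tauI.
have rX2 n t : s <= t -> t <= s1 -> (r ^+ n)%g (al t) = al ((tau^-1 ^+ n)%g t) /\
    s <= (tau^-1 ^+ n)%g t /\ (tau^-1 ^+ n)%g t <= s1.
  move=> h1 h2; elim: n => // n [IH [h3 h4]].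
  by rewrite !oaut_expS IH rE2 //; split=> //; exact: tauVI.
have phiC' : commute phi (al ^+ 2)%g by exact: commute_sym.
have rfix t : t <= p \/ q <= t -> r t = t.
  move=> ht; have at_ : al t = t by case: ht => [/al1|/al2].
  have pt : phi t = t by case: ht => [/phi1|/phi2].
  by rewrite rE (oaut_fixV pt) at_ pt oaut_fixV.
have rho4 t : rho ((tau ^+ 4)%g t) = (tau ^+ 4)%g (rho t).
  by rewrite -!oautM -rhoC.
have r4C : commute (al ^+ 2)%g (r ^+ 4)%g.
  apply: commuteX; rewrite /r commgEl conjgE invgK.
  have ca : commute (al ^+ 2)%g al by apply: commute_sym; exact: commuteX.
  by do !apply: commuteM => //; apply: commuteV.
have a2lt : s < (al ^+ 2)%g s by rewrite a2s; exact: lt_trans s12.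
split=> //.
- apply: oaut_eq => t; rewrite [LHS]oautM [RHS]oautM.
  have [ht|ht] := pselect (p < t /\ t < q); last first.
    have ht' : t <= p \/ q <= t.
      case: (leP t p) => [|pt]; first by left.
      by right; rewrite leNgt; apply/negP => tq; apply: ht.
    have pt : phi t = t by case: ht' => [/phi1|/phi2].
    by rewrite (oaut_fixX 4%N (rfix t ht')) pt (oaut_fixX 4%N (rfix t ht')).
  have St : oaut_span (al ^+ 2)%g s t by apply/(bump_span a2lt t alP ps sq).
  (* Commutation is checked on [s, s2[: [rho] against [tau ^+ 4] on the first half, and on the
     second the [al]-copies of [tau * rho] and [tau ^- 4]. *)
  apply: (oaut_span_commute phiC r4C _ St) => y sy.
  rewrite a2s => ys2; have [ys1|/ltW s1y] := leP y s1.
    have [-> [h1 h2]] := rX1 4%N y sy ys1.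
    have [h3 h4] := rhoI y sy ys1.
    by rewrite !phiE1 // (rX1 4%N _ h3 h4).1 rho4.
  pose x := (al^-1)%g y; have yE : y = al x by rewrite /x oautVK.
  have sx : s <= x by rewrite oaut_leV_r.
  have xs : x <= s1 by rewrite oaut_leV ltW.
  have [h1 h2] := rhoI x sx xs; have [h3 h4] := tauI _ h1 h2.
  rewrite yE (rX2 4%N x sx xs).1 !phiE2 ?(rX2 4%N x sx xs).2.1 ?(rX2 4%N x sx xs).2.2 //.
  rewrite (rX2 4%N (tr x) h3 h4).1 /tr; congr (al _).
  suff C : commute (tau * rho)%g (tau^-1 ^+ 4)%g.
    by rewrite -!oautM C.
  apply: commute_sym; rewrite expVgn; apply: commuteM.
    by apply: commute_sym; apply: commuteV; exact: commuteX.
  by apply: commute_sym; apply: commuteV; exact: commute_sym.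
- move=> z1.
  have zE0 t : z t = ((r ^+ 2)^-1)%g (phi ((r ^+ 2)%g ((phi^-1)%g t))).
    by rewrite /z commgEl conjgE invgK.
  (* In [r ^- 2 * phi * r ^+ 2 * phi^-1] the inner [phi] is applied to a point of [u2, u4], where it
     is the identity; only [phi^-1], that is [ka^-1], remains. *)
  have zE y : u <= y -> y <= u2 -> z y = (ka^-1)%g y.
    move=> uy yu2.
    have [sy ys] : s <= y /\ y <= s1 by split; lra.
    have k1 : u <= (ka^-1)%g y by rewrite oaut_leV_r ka1.
    have k2 : (ka^-1)%g y <= u2 by rewrite oaut_leV ka2.
    have rk : rho ((ka^-1)%g y) = y by rewrite rhoE ?oautVK //; lra.
    have pk : (phi^-1)%g y = (ka^-1)%g y.
      by rewrite phiVE1 //; apply/oautE_V; rewrite rk.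
    set w := (ka^-1)%g y in k1 k2 rk pk *.
    have sw : s <= w by lra. have ws : w <= s1 by lra.
    have [E [h1 h2]] := rX1 2%N w sw ws.
    rewrite zE0 pk E; apply/oautE_V.
    rewrite E phiE1 // rhoE ?ka2 //.
      by rewrite oaut_le.
    by apply: le_trans (k1) _; apply/ltW/(bump_pow_gt 1%N tauP); lra.
    by apply: (@le_trans _ _ u4) => //; rewrite u4E oaut_le.
  pose m := (u + u2) / 2.
  have um : u < m by rewrite /m; lra. have mu2 : m < u2 by rewrite /m; lra.
  have ky : (ka^-1)%g m < m by rewrite oaut_ltV; exact: ka3.
  have uk : u <= (ka^-1)%g m by rewrite oaut_leV_r ka1 // ltW.
  have : (z ^+ 2)%g m < m.
    rewrite expg2 oautM !zE; try lra.
    by apply: lt_trans (ky); rewrite oaut_lt.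
  by rewrite z1 oaut1 ltxx.
Qed.

End Twist.

End Bump.

(** * The square root *)

Section Construction.
Variable R : realType.
Local Open Scope ring_scope.

Local Notation f0 := (pushR R).
Local Notation g := (pushL R).
Local Notation A := (pushR R ^+ 2)%g.
Local Notation B := (pushL R ^+ 2)%g.

(** The power [(A * B) ^+ n.+1] sends [0, +oo[ beyond 3, where [B] is the identity. *)
Lemma push_gen_fix n t : 0 <= t -> thompson_gen A B n.+2 t = t.
Proof.
move=> t0; rewrite thompson_gen_apply; apply/oautE_V.
have x0 x : x <= (A * B)%g x.
  by rewrite oautM; apply: le_trans (pushR2_ge _); exact: pushL2_ge.
have xn k x : x <= ((A * B) ^+ k)%g x.
  by elim: k => // k IH; rewrite oaut_expS; exact: le_trans (x0 _).
rewrite pushL2_fix // expgS oautM.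
by rewrite -oaut_leV push_corner; apply: le_trans t0 _; exact: xn.
Qed.

Lemma push_commute n : commute A (thompson_gen A B n.+2).
Proof.
apply: (@oaut_commute_disjoint R _ _ (fun t => t <= 0)).
- exact: pushR2_fix.
- by move=> t /negP; rewrite -ltNge => /ltW; exact: push_gen_fix.
- by move=> t t0; rewrite -(@push_gen_fix n 0 (lexx 0)) oaut_le.
Qed.

Lemma push_iso : isomorphic (generated [set homeo_of A; homeo_of B]%classic) thompsonF.
Proof.
apply: (@thompson_iso R A B 3); try exact: push_commute.
- exact: pushR2_ge.
- exact: pushL2_ge.
- by apply: pushR2_gt.
- exact: pushL2_fix.
- by rewrite push_corner; apply: pushL2_gt.
Qed.

(** An element of the group generated by [A] and [B] that compresses [0, 3] to [17/16, 5/4], which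
    is disjoint from its translate by 1 and lies in half of the fundamental domain [1, 3] of [A]. *)
Definition spread : oaut R := (B * A ^- 2 * B)%g.

Lemma spread0 : spread 0 = 17 / 16.
Proof.
have B0 : B 0 = 1 :> R by rewrite pushL2_shift; lra.
rewrite /spread oautM oautM B0; have -> : (A ^- 2)%g 1 = 16^-1 :> R.
  apply/oautE_V; rewrite (expg2 A) oautM !pushR2_scale; lra.
by rewrite pushL2_shift; lra.
Qed.

Lemma spread3 : spread 3 = 5 / 4.
Proof.
rewrite /spread oautM oautM (pushL2_fix (lexx 3)).
have -> : (A ^- 2)%g 3 = 4^-1 :> R.
  have A1 : A 4^-1 = 1 :> R by rewrite pushR2_scale; lra.
  by apply/oautE_V; rewrite (expg2 A) oautM A1 pushR2_shift; lra.
by rewrite pushL2_shift; lra.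
Qed.

(* The root is [c^-1 * pushR * c] where [c] commutes with [A] and, on the fundamental
   domain [1, 3] of [A], is a copy of [phi] supported in [17 / 16, 5 / 4], where
   [pushR] and [B] are both the translation by 1. *)
Lemma twisted_root (phi : oaut R) :
  (forall t, t <= 0 -> phi t = t) -> (forall t, 3 <= t -> phi t = t) ->
  exists f : oaut R, [/\ (f ^+ 2)%g = A, forall t, f t <> t <-> 0 < t
    & forall t, 0 <= t -> t <= 3 -> (spread^-1 * B^-1 * f * spread)%g t = phi t].
Proof.
move=> phi0 phi3.
have num1 (x : R) : 17 / 16 <= x -> [/\ 1 <= x, 5 / 4 <= x + 1 & 1 <= x + 1].
  by move=> hx; split; lra.
have num2 (x : R) : x <= 5 / 4 -> [/\ x <= 3, x + 1 <= 3 & x <= 3 / 2].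
  by move=> hx; split; lra.
pose ps := (spread * phi * spread^-1)%g.
have psE t : ps (spread t) = spread (phi t) by rewrite /ps !oautM oautK.
have ps_left t : t <= 17 / 16 -> ps t = t.
  rewrite -spread0 -oaut_leV => h.
  by rewrite -{1}(oautVK spread t) psE phi0 // oautVK.
have ps_right t : 5 / 4 <= t -> ps t = t.
  rewrite -spread3 -oaut_leV_r => h.
  by rewrite -{1}(oautVK spread t) psE phi3 // oautVK.
have A1 : A 1 = 3 :> R by rewrite pushR2_shift; lra.
have lt1 : 1 < A 1 :> R by rewrite A1; lra.
have ps1 : ps 1 = 1 by apply: ps_left; lra.
have psA1 : ps (A 1) = A 1 by rewrite A1; apply: ps_right; lra.
have [c [cA cE cout]] := periodize lt1 ps1 psA1.
have A0 : A 0 = 0 :> R by apply: pushR2_fix.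
have c0 t : t <= 0 -> c t = t.
  move=> t0; apply: cout => st.
  by have := lt_le_trans (oaut_span_fix_lt A0 ltr01 st) t0; rewrite ltxx.
pose f := (c^-1 * f0 * c)%g.
have fE t : f t = (c^-1)%g (f0 (c t)) by [].
have f2 : (f ^+ 2 = A)%g.
  have -> : (f ^+ 2 = c^-1 * A * c)%g.
    by rewrite !expg2 /f !mulgA; congr (_ * _)%g; rewrite -!mulgA mulVKg.
  by rewrite -mulgA cA mulKg.
exists f; split=> // [t|t t0 t3].
- have cpos x : (0 < c x) = (0 < x).
    by rewrite -[X in X < c x](c0 0) // oaut_lt.
  split=> [ft|t0].
    rewrite ltNge; apply/negP => t0; apply: ft.
    by rewrite fE c0 // pushR_fix // oaut_fixV // c0.
  rewrite fE => /oautE_V e; have := pushR_gt (etrans (cpos t) t0).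
  by rewrite e ltxx.
- have sI x : 0 <= x -> x <= 3 -> 17 / 16 <= spread x /\ spread x <= 5 / 4.
    by rewrite -spread0 -spread3 !oaut_le.
  have p0 : 0 <= phi t by rewrite -[X in X <= _](phi0 0) // oaut_le.
  have p3 : phi t <= 3 by rewrite -[X in _ <= X](phi3 3) // oaut_le.
  have [l1 l2] := sI _ t0 t3; have [l3 l4] := sI _ p0 p3.
  have [l1' _ _] := num1 _ l1; have [l2' _ _] := num2 _ l2.
  have [l31 l32 l33] := num1 _ l3; have [_ l42 l43] := num2 _ l4.
  (* On the compressed interval [c] acts as the copy of [phi]; [pushR] then translates by 1 to where
     [c] is the identity, and [B^-1] translates back. *)
  have cs : c (spread t) = spread (phi t) by rewrite cE ?A1 ?psE.
  have cf : c (spread (phi t) + 1) = spread (phi t) + 1.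
    by rewrite cE ?A1 ?ps_right.
  rewrite 3!oautM fE cs pushR_shift // (oaut_fixV cf); apply/oautE_V; apply/oautE_V.
  by rewrite pushL2_shift.
Qed.

Lemma gen_pred_mem (G : groupType) (S : set G) x : S x -> x \in gen_pred S.
Proof. by move=> Sx; apply/asboolP => H _; exact. Qed.

(** Conjugating [x] by [n * c] or by [n] gives the same result when [c] centralizes [x]. *)
Lemma commg_absorb (G : groupType) (x n c : G) : commute x c ->
  ([~ x, (n * c)^-1] = [~ x, n^-1])%g.
Proof.
move=> xc; rewrite !commgEl invgM conjgM; congr (_ * _ ^ _)%g.
by rewrite conjgE invgK mulgA -xc mulgK.
Qed.

Lemma oaut_commute_inside (p q : R) (chi h : oaut R) : p <= q ->
  (forall t, p <= t -> t <= q -> chi t = t) ->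
  (forall t, t <= p -> h t = t) -> (forall t, q <= t -> h t = t) -> commute h chi.
Proof.
move=> pq chiE hp hq; apply: commute_sym.
apply: (@oaut_commute_disjoint R _ _ (fun t => p <= t /\ t <= q)) => t.
- by move=> [pt tq]; exact: chiE.
- move=> nt; case: (leP t p) => [/hp //|/ltW pt].
  by apply: hq; rewrite leNgt; apply/negP => /ltW tq; exact: nt (conj pt tq).
- move=> [pt tq]; rewrite -[X in X <= _ /\ _](hp p (lexx p)).
  by rewrite -[X in _ /\ _ <= X](hq q (lexx q)) !oaut_le.
Qed.

(* Only the values of the conjugator inside the common support matter. *)
Lemma twist_local (p q : R) (al phi eta : oaut R) :
  let r := [~ al, phi^-1]%g in p <= q ->
  (forall t, t <= p -> al t = t) -> (forall t, q <= t -> al t = t) ->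
  (forall t, t <= p -> phi t = t) -> (forall t, q <= t -> phi t = t) ->
  (forall t, p <= t -> t <= q -> eta t = phi t) ->
  commute phi (al ^+ 2)%g -> commute phi (r ^+ 4)%g ->
  [/\ [~ al, eta^-1]%g = r, [~ r ^+ 2, eta^-1]%g = [~ r ^+ 2, phi^-1]%g,
    commute eta (al ^+ 2)%g & commute eta (r ^+ 4)%g].
Proof.
move=> r pq alp alq phip phiq etaE c2 c4.
pose chi := (phi^-1 * eta)%g.
have -> : eta = (phi * chi)%g by rewrite /chi mulVKg.
have chiE t : p <= t -> t <= q -> chi t = t.
  by move=> pt tq; rewrite /chi oautM etaE // oautK.
have rE t : r t = (al^-1)%g (phi (al ((phi^-1)%g t))).
  by rewrite /r commgEl conjgE invgK.
have chial : commute al chi by exact: oaut_commute_inside chiE alp alq.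
have chir : commute r chi.
  apply: (oaut_commute_inside pq chiE) => t ht; rewrite rE.
    by rewrite (oaut_fixV (phip t ht)) (alp t ht) (phip t ht) (oaut_fixV (alp t ht)).
  by rewrite (oaut_fixV (phiq t ht)) (alq t ht) (phiq t ht) (oaut_fixV (alq t ht)).
have cX (g : oaut R) n : commute g chi -> commute (g ^+ n)%g chi.
  by move=> gc; apply: commute_sym; apply: commuteX; exact: commute_sym.
split.
- exact: commg_absorb.
- by apply: commg_absorb; exact: cX.
- by apply: commute_sym; apply: commuteM; [exact: commute_sym | exact: cX].
- by apply: commute_sym; apply: commuteM; [exact: commute_sym | exact: cX].
Qed.

Lemma root_with_reversed_elements : exists (f : oaut R) (v r z : oaut R),
  [/\ (f ^+ 2)%g = A, forall t, f t <> t <-> 0 < t,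
    [/\ v \in gen_pred [set f; g]%classic, r \in gen_pred [set f; g]%classic
       & z \in gen_pred [set f; g]%classic]
    & [/\ (v * r = r^-1 * v)%g, (r ^+ 2 * z = z^-1 * r ^+ 2)%g & (z ^+ 2)%g <> 1%g]].
Proof.
have r03 : 0 < 3 :> R by rewrite ltr0n.
have [phi [phi0 phi3 phia phir phiz]] := twist_exists r03 (bump03P R).
have [f [f2 fsupp fE]] := twisted_root phi0 phi3.
have [al0 al3 _] := bump03P R.
have [rE zE c2 c4] := twist_local (ltW r03) al0 al3 phi0 phi3 fE phia phir.
rewrite -zE in phiz; rewrite -rE in phiz c4.
(* [eta] belongs to the group generated by [f] and [g] and agrees with [phi] on [0, 3], so it
   replaces [phi] in both commutators. *)
set eta := (spread^-1 * B^-1 * f * spread)%g in rE zE c2 c4 phiz.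
have Hc := gen_pred_closed [set f; g]%classic.
have HM := group_closedM Hc; have HV := group_closedV Hc.
have HX x n : x \in gen_pred [set f; g]%classic -> (x ^+ n)%g \in gen_pred [set f; g]%classic.
  by move=> xg; elim: n => [|n IH]; [case: Hc | rewrite expgS; exact: HM].
have HR x y : x \in gen_pred [set f; g]%classic -> y \in gen_pred [set f; g]%classic ->
    [~ x, y]%g \in gen_pred [set f; g]%classic.
  by move=> xg yg; apply: (HM); [exact: HV | apply: (HM); [exact: HV | exact: HM]].
have Af : A \in gen_pred [set f; g]%classic.
  by rewrite -f2; apply: (HX); apply: gen_pred_mem; left.
have fg : f \in gen_pred [set f; g]%classic by apply: gen_pred_mem; left.
have Bg : B \in gen_pred [set f; g]%classic.
  by apply: (HX); apply: gen_pred_mem; right.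
have alg : bump03 R \in gen_pred [set f; g]%classic.
  exact: (HM _ _ (HM _ _ (HM _ _ Bg (HV _ Af)) (HV _ Bg)) Af).
have sg : spread \in gen_pred [set f; g]%classic.
  exact: (HM _ _ (HM _ _ Bg (HV _ (HX _ 2%N Af))) Bg).
have eg : eta \in gen_pred [set f; g]%classic.
  exact: (HM _ _ (HM _ _ (HM _ _ (HV _ sg) (HV _ Bg)) fg) sg).
have rg := HR _ _ alg (HV _ eg); have zg := HR _ _ (HX _ 2%N rg) (HV _ eg).
exists f, (bump03 R), [~ bump03 R, eta^-1]%g, [~ [~ bump03 R, eta^-1] ^+ 2, eta^-1]%g.
split; [exact: f2 | exact: fsupp | by split | ].
split; [exact: commg_reverses c2 | apply: commg_reverses | exact: phiz].
by rewrite -expgnA.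
Qed.

End Construction.

(** * Distortion and reversed elements *)

Section Distortion.
Variable R : realType.
Local Open Scope ring_scope.
Implicit Types (F : R -> R) (a b c x y : R).

Lemma derivable_continuous F : (forall x, derivable F x 1) -> continuous F.
Proof. by move=> dF x; apply: differentiable_continuous; apply/derivable1_diffP. Qed.

Lemma mean_value F x y : (forall x, derivable F x 1) -> x <= y ->
  exists2 z, x <= z <= y & F y - F x = (F^`()%classic z) * (y - x).
Proof.
move=> dF xy; have [t _||z] := @MVT_segment R F F^`()%classic x y xy.
- by rewrite derive1E; apply: derivableP; exact: dF.
- by apply: continuous_subspaceT => t; exact: derivable_continuous.
by rewrite in_itv /= => hz E; exists z.
Qed.

Lemma derive_bounded F a b : continuous F^`()%classic -> a <= b ->
  exists2 K, 0 < K & forall x, a <= x <= b -> `|F^`()%classic x| <= K.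
Proof.
move=> cF ab.
have [|c _ hc] := @EVT_max R (fun x => `|F^`()%classic x|) a b ab.
  apply: continuous_subspaceT => t.
  by apply: continuous_comp; [exact: cF | exact: norm_continuous].
exists (`|F^`()%classic c| + 1); first exact: ltr_wpDl.
move=> x hx; apply: (@le_trans _ _ `|F^`()%classic c|); last by lra.
by apply: hc; rewrite in_itv.
Qed.

Lemma C1_lipschitz F a b : (forall x, derivable F x 1) -> continuous F^`()%classic ->
  a <= b -> exists2 K, 0 < K &
    forall x y, a <= x -> x <= y -> y <= b -> `|F y - F x| <= K * (y - x).
Proof.
move=> dF cF ab; have [K K0 hK] := derive_bounded cF ab; exists K => // x y ax xy yb.
have [z hz ->] := mean_value dF xy; rewrite normrM (ger0_norm (x := y - x)); last by lra.
by apply: ler_wpM2r; [lra | apply: hK; lra].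
Qed.

(** Regularity up to the ends of [a, b], in a form common to maps of the line, extensions from the
    interval and lifts from the circle. *)
Definition C2_on a b (f : R -> R) : Prop :=
  exists2 F, C2 F & forall t, a <= t <= b -> f t = F t.

Lemma C2_on_sub a b c d f : a <= c -> d <= b -> C2_on a b f -> C2_on c d f.
Proof. by move=> ac db [F CF fF]; exists F => // t ht; apply: fF; lra. Qed.

Lemma C2_on_lipschitz a b f : a <= b -> C2_on a b f -> exists2 K, 0 < K &
  forall x y, a <= x -> x <= y -> y <= b -> f y - f x <= K * (y - x).
Proof.
move=> ab [F [dF ddF _] fF].
have [K K0 hK] := C1_lipschitz dF (derivable_continuous ddF) ab.
exists K => // x y ax xy yb; rewrite !fF; try lra.
by apply: le_trans (ler_norm _) _; exact: hK.
Qed.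

(** Slopes of chords over subintervals of [s, t] are values of the derivative on [s, t], and the
    derivative is Lipschitz. *)
Lemma C2_on_slopes a b f : a <= b -> C2_on a b f -> exists2 K, 0 < K &
  forall s t x y x' y', a <= s -> t <= b ->
    s <= x -> x < y -> y <= t -> s <= x' -> x' < y' -> y' <= t ->
    (f y - f x) / (y - x) <= (f y' - f x') / (y' - x') + K * (t - s).
Proof.
move=> ab [F [dF ddF cF] fF].
have [K K0 hK] := C1_lipschitz ddF cF ab.
exists K => // s t x y x' y' as_ tb sx xy yt sx' xy' yt'; rewrite !fF; try lra.
have slope u v : u < v -> exists2 z, u <= z <= v & (F v - F u) / (v - u) = F^`()%classic z.
  move=> uv; have [z hz E] := mean_value dF (ltW uv); exists z => //.
  by rewrite E mulfK // subr_eq0 gt_eqF.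
have [z hz ->] := slope _ _ xy; have [z' hz' ->] := slope _ _ xy'.
rewrite -lerBlDl; apply: le_trans (ler_norm _) _.
have [zz|/ltW zz] := leP z' z.
  apply: le_trans (hK z' z _ zz _) _; try lra.
  by apply: ler_wpM2l; [exact: ltW | lra].
rewrite distrC; apply: le_trans (hK z z' _ zz _) _; try lra.
by apply: ler_wpM2l; [exact: ltW | lra].
Qed.

(** * Contractions towards a fixed point and the elements they reverse *)

Section Contraction.
Variables (a c : R) (h : oaut R).
Hypotheses (ac : a < c) (ha : h a = a) (hlt : forall t, a < t -> t <= c -> h t < t).

Let cn n : R := (h ^+ n)%g c.

Let cn_gt n : a < cn n.
Proof. by rewrite /cn -[X in X < _](oaut_fixX n ha) oaut_lt. Qed.

Let cn_le n : cn n <= c.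
Proof.
elim: n => [|n IH]; first exact: lexx.
by apply: le_trans (IH); rewrite /cn oaut_expS; apply/ltW/hlt; first exact: cn_gt.
Qed.

Let cnS n : cn n.+1 < cn n.
Proof. by rewrite /cn oaut_expS; apply: hlt; [exact: cn_gt | exact: cn_le]. Qed.

Lemma contraction_cvg e : 0 < e -> exists n, (h ^+ n)%g c < a + e.
Proof.
move=> e0; apply: contrapT => nex.
have [|n|t [at_ tc ht]] := @oaut_orbit_lb R h c (a + e).
- by apply/ltW/hlt.
- by rewrite leNgt; apply/negP => hn; apply: nex; exists n.
have : h t < t by apply: hlt => //; lra.
by rewrite ht ltxx.
Qed.

(* Bounded distortion: the intervals [h^i c, h^(i+1) c] are disjoint, so the
   distortions of the successive iterates add up to a bounded quantity. *)
Lemma bounded_distortion :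
  C2_on a c h -> C2_on a c (h^-1)%g -> exists2 C, 0 < C &
  forall n u v u' v', h c <= u -> u < v -> v <= c -> h c <= u' -> u' < v' -> v' <= c ->
    ((h ^+ n)%g v - (h ^+ n)%g u) * (v' - u') <=
    C * ((h ^+ n)%g v' - (h ^+ n)%g u') * (v - u).
Proof.
move=> C2h C2hV.
have [K K0 slopes] := C2_on_slopes (ltW ac) C2h.
have [L L0 lipV] := C2_on_lipschitz (ltW ac) C2hV.
pose M := K * L.
have M0 : 0 < M by exact: mulr_gt0.
(* One iteration: the additive bound [K * (t - s)] between slopes becomes multiplicative, because
   the slopes of [h] are at least [1 / L], where [L] is a Lipschitz constant of [h^-1]. *)
have step s t u v u' v' : a <= s -> t <= c ->
    s <= u -> u < v -> v <= t -> s <= u' -> u' < v' -> v' <= t ->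
    (h v - h u) * (v' - u') <= expR (M * (t - s)) * ((h v' - h u') * (v - u)).
  move=> as_ tc su uv vt su' uv' vt'.
  have d : 0 < v - u by lra.
  have d' : 0 < v' - u' by lra.
  have hd' : 0 < h v' - h u' by rewrite subr_gt0 oaut_lt.
  have hua t' : a <= t' -> t' <= c -> a <= h t' <= c.
    move=> at_ tc'; rewrite -[X in X <= _]ha oaut_le at_ /=.
    by apply: le_trans (cn_le 1); rewrite /cn expg1 oaut_le.
  have Lb : v' - u' <= L * (h v' - h u').
    have /andP[u1 u2] : a <= h u' <= c by apply: hua; lra.
    have /andP[v1 v2] : a <= h v' <= c by apply: hua; lra.
    have := lipV (h u') (h v'); rewrite !oautK; apply=> //.
    by rewrite oaut_le ltW.
  have E : (h v - h u) / (v - u) <= expR (M * (t - s)) * ((h v' - h u') / (v' - u')).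
    apply: le_trans (slopes s t u v u' v' _ _ _ _ _ _ _ _) _ => //.
    set X := (h v' - h u') / (v' - u').
    have X1 : 1 <= L * X by rewrite /X mulrA ler_pdivlMr // mul1r.
    have X0 : 0 < X by exact: divr_gt0.
    apply: (@le_trans _ _ ((1 + M * (t - s)) * X)); last first.
      by rewrite ler_pM2r // expR_ge1Dx.
    rewrite mulrDl mul1r lerD2l /M -mulrA.
    rewrite [X in _ <= X](_ : _ = K * (t - s) * (L * X)); last by ring.
    rewrite ler_peMr // mulr_ge0 ?ltW //; lra.
  move: E; rewrite ler_pdivrMr // => E.
  apply: le_trans (ler_wpM2r (ltW d') E) _.
  rewrite le_eqVlt; apply/orP; left; apply/eqP.
  by field; rewrite subr_eq0 gt_eqF.
exists (expR (M * (c - a))); first exact: expR_gt0.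
move=> n u v u' v' cu uv vc cu' uv' vc'.
have itn i t : h c <= t -> t <= c -> cn i.+1 <= (h ^+ i)%g t <= cn i.
  by move=> h1 h2; rewrite /cn expgSr oautM !oaut_le h1.
(* The exponents [M * (cn i - cn i.+1)] of the successive steps telescope. *)
have : ((h ^+ n)%g v - (h ^+ n)%g u) * (v' - u') <=
    expR (M * (c - cn n)) * (((h ^+ n)%g v' - (h ^+ n)%g u') * (v - u)).
  elim: n => [|n IH].
    by rewrite /cn expg0 !oaut1 subrr mulr0 expR0 mul1r mulrC.
  rewrite !oaut_expS; move: IH.
  set U := (h ^+ n)%g u; set V := (h ^+ n)%g v.
  set U' := (h ^+ n)%g u'; set V' := (h ^+ n)%g v' => IH.
  have UV : U < V by rewrite oaut_lt.
  have UV' : U' < V' by rewrite oaut_lt.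
  have /andP[b1 _] := itn n u cu (le_trans (ltW uv) vc).
  have /andP[_ b4] := itn n v (le_trans cu (ltW uv)) vc.
  have /andP[b5 _] := itn n u' cu' (le_trans (ltW uv') vc').
  have /andP[_ b8] := itn n v' (le_trans cu' (ltW uv')) vc'.
  have := step (cn n.+1) (cn n) U V U' V'.
  move=> /(_ (ltW (cn_gt _)) (cn_le _) b1 UV b4 b5 UV' b8) S.
  have -> : M * (c - cn n.+1) = M * (cn n - cn n.+1) + M * (c - cn n) by ring.
  rewrite expRD -(ler_pM2r (x := V' - U')); last by lra.
  rewrite [X in X <= _]mulrAC.
  apply: le_trans (ler_wpM2r _ S) _; first by lra.
  rewrite [X in X <= _](_ : _ = (expR (M * (cn n - cn n.+1)) * (h V' - h U')) *
    ((V - U) * (v' - u'))); last by ring.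
  apply: le_trans (ler_wpM2l _ IH) _.
    by rewrite mulr_ge0 ?expR_ge0 // subr_ge0 oaut_le ltW.
  by rewrite le_eqVlt; apply/orP; left; apply/eqP; ring.
move/le_trans; apply; rewrite -mulrA ler_wpM2r //.
  by rewrite mulr_ge0 // subr_ge0 ?oaut_le ltW.
by rewrite ler_expR ler_wpM2l ?ltW //; have := cn_gt n; lra.
Qed.

Definition reverses (q y : oaut R) := (q * y = y^-1 * q)%g.

(** If [y] moved [t] to one side, then [y^-1 t = q (y t)] would be on the same side of [t], as [q]
    is increasing and fixes [t]. *)
Lemma reverses_fix (q y : oaut R) t : reverses q y -> q t = t -> y t = t.
Proof.
move=> qy qt; have E : q (y t) = (y^-1)%g t by rewrite -[in RHS]qt -!oautM qy.
case: (ltgtP (y t) t) => // yt.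
  have : q (y t) < t by rewrite -[X in _ < X]qt oaut_lt.
  by rewrite E oaut_ltV => yt'; have := lt_trans yt yt'; rewrite ltxx.
have : t < q (y t) by rewrite -[X in X < _]qt oaut_lt.
by rewrite E oaut_ltV_r => yt'; have := lt_trans yt yt'; rewrite ltxx.
Qed.

Lemma reverses_fix_image (q y : oaut R) t : reverses q y -> y t = t -> y (q t) = q t.
Proof.
move=> qy yt; have := congr1 (fun g : oaut R => g t) qy.
by rewrite !oautM yt => /esym/oautE_V/esym.
Qed.

Lemma reversesV (q y : oaut R) : reverses q y -> reverses q y^-1%g.
Proof.
move=> qy; rewrite /reverses invgK; apply: (mulIg y).
by rewrite mulgVK -mulgA qy mulVKg.
Qed.

Lemma reversesVl (q y : oaut R) : reverses q y -> reverses q^-1%g y.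
Proof.
move=> qy; apply: (mulgI q); apply: (mulIg q).
by rewrite mulVKg -!mulgA mulVg mulg1 (reversesV qy) invgK.
Qed.

(* Since [l] fixes the points [h^n c], its slope tends to 1 at [a]. *)
Lemma slope_near_fix (l : oaut R) : C2_on a c l -> l c = c -> reverses h l -> exists2 K, 0 < K &
  forall n m u v, a <= u -> u < v -> v <= (h ^+ n)%g c ->
    (l ^+ m)%g v - (l ^+ m)%g u <= (1 + K * ((h ^+ n)%g c - a)) ^+ m * (v - u).
Proof.
move=> C2l lc hl.
have la : l a = a by exact: reverses_fix hl ha.
have lcn n : l (cn n) = cn n.
  by elim: n => // n IH; rewrite /cn oaut_expS; apply: reverses_fix_image IH.
have [K K0 slopes] := C2_on_slopes (ltW ac) C2l.
exists K => // n m u v au uv vn; elim: m => [|m IH]; first by rewrite expr0 mul1r !expg0.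
set e := 1 + _ in IH *.
have e0 : 0 < e.
  have := mulr_gt0 K0 (_ : 0 < cn n - a); rewrite subr_gt0 => /(_ (cn_gt n)).
  by rewrite /e -/(cn n); lra.
rewrite !oaut_expS exprS -mulrA; apply: le_trans (ler_wpM2l (ltW e0) IH).
have lt_m : (l ^+ m)%g u < (l ^+ m)%g v by rewrite oaut_lt.
rewrite -ler_pdivrMr ?subr_gt0 //.
(* The comparison chord joins [cn n.+1] to [cn n]; both are fixed by [l], so its slope is exactly
   1. *)
apply: le_trans (slopes a (cn n) _ _ (cn n.+1) (cn n) _ _ _ lt_m _ _ _ _) _ => //.
- by rewrite -[X in X <= _](oaut_fixX m la) oaut_le.
- by rewrite -[X in _ <= X](oaut_fixX m (lcn n)) oaut_le.
- exact/ltW/cn_gt.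
- by rewrite !lcn divff // subr_eq0 gt_eqF.
Qed.

(** Each factor [h] inverts [l], so the sign depends on the parity of [n]. *)
Lemma reverses_power (l : oaut R) n m : reverses h l ->
  exists2 L, L = l \/ L = l^-1%g & (h ^+ n * l ^+ m = L ^+ m * h ^+ n)%g.
Proof.
move=> hl; elim: n => [|n [L HL E]]; first by exists l; [left | rewrite mul1g mulg1].
exists L^-1%g; first by case: HL => ->; [right | left; rewrite invgK].
have hL : reverses h L by case: HL => -> //; exact: reversesV.
rewrite expgS -mulgA E mulgA; elim: m {E} => [|m IH]; first by rewrite mulg1 mul1g.
by rewrite !expgS mulgA (hL : _ = _) -!mulgA; congr (_ * _)%g; rewrite -mulgA in IH.
Qed.

(** The map [h ^+ n] conjugates [l ^+ m] to a power of [l] or [l^-1] close to [a], where slopes are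
    almost 1. The cost of this conjugation is the distortion constant, which depends neither on [n]
    nor on [m]. *)
Lemma reverses_iterates_lipschitz (l : oaut R) :
  C2_on a c h -> C2_on a c (h^-1)%g -> C2_on a c l -> C2_on a c (l^-1)%g ->
  l c = c -> reverses h l -> exists2 C, 0 < C & forall m u v, h c <= u -> u < v -> v <= c ->
    (l ^+ m)%g v - (l ^+ m)%g u <= C * (v - u).
Proof.
move=> C2h C2hV C2l C2lV lc hl.
have [C C0 dist] := bounded_distortion C2h C2hV.
have [K1 K10 s1] := slope_near_fix C2l lc hl.
have [K2 K20 s2] := slope_near_fix C2lV (oaut_fixV lc) (reversesV hl).
have lhc : l (h c) = h c by exact: reverses_fix_image hl lc.
exists (C * expR 1); first by rewrite mulr_gt0 ?expR_gt0.
move=> m u v cu uv vc.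
pose K := Num.max K1 K2.
have K0 : 0 < K by rewrite lt_max K10.
(* With [n] this large, slopes near [a] are at most [1 + 1 / m.+1], whose power of exponent [m] is
   at most [e]. *)
have [n hn] : exists n, cn n < a + (m.+1%:R * K)^-1.
  by apply: contraction_cvg; rewrite invr_gt0 mulr_gt0 // ltr0n.
have bound L : L = l \/ L = l^-1%g -> forall u v, a <= u -> u < v -> v <= cn n ->
    (L ^+ m)%g v - (L ^+ m)%g u <= expR 1 * (v - u).
  move=> HL u' v' au' uv' vn'.
  have [K' [K'0 K'K s]] : exists K', [/\ 0 < K', K' <= K & (L ^+ m)%g v' - (L ^+ m)%g u' <=
      (1 + K' * (cn n - a)) ^+ m * (v' - u')].
    case: HL => ->; first by exists K1; split=> //; [rewrite le_max lexx | exact: s1].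
    by exists K2; split=> //; [rewrite le_max lexx orbT | exact: s2].
  apply: le_trans s _; rewrite ler_wpM2r; [by [] | by lra | ].
  have an := cn_gt n.
  have e : K' * (cn n - a) <= m.+1%:R^-1.
    apply: (@le_trans _ _ (K * (m.+1%:R * K)^-1)).
      apply: ler_pM => //; [exact: ltW | by rewrite subr_ge0 ltW | by rewrite lerBlDl ltW].
    by rewrite invfM mulrC divfK ?gt_eqF.
  apply: (@le_trans _ _ (expR (m.+1%:R^-1) ^+ m)).
    apply: lerXn2r; rewrite ?nnegrE ?expR_ge0 //.
      by have := mulr_gt0 K'0 (_ : 0 < cn n - a); rewrite subr_gt0 => /(_ an); lra.
    by apply: le_trans (expR_ge1Dx _); rewrite lerD2l.
  by rewrite -expRM_natl ler_expR ler_pdivrMr ?ltr0n // mul1r ler_nat.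
have [L HL E] := reverses_power n m hl.
have d : 0 < (h ^+ n)%g v - (h ^+ n)%g u by rewrite subr_gt0 oaut_lt.
have fX t : l t = t -> (l ^+ m)%g t = t by move=> lt; exact: oaut_fixX.
(* Distortion is applied to [u, v] and its image under [l ^+ m], which stays in [h c, c] because [l]
   fixes both ends. *)
have := dist n u v ((l ^+ m)%g u) ((l ^+ m)%g v) cu uv vc.
rewrite -[X in X <= (l ^+ m)%g u](fX _ lhc) -[X in (l ^+ m)%g v <= X](fX _ lc).
rewrite !oaut_le oaut_lt => /(_ cu uv vc); rewrite -!oautM E !oautM => D.
have B : (L ^+ m)%g ((h ^+ n)%g v) - (L ^+ m)%g ((h ^+ n)%g u) <=
    expR 1 * ((h ^+ n)%g v - (h ^+ n)%g u).
  apply: bound => //; last by rewrite /cn oaut_le.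
    rewrite -[X in X <= _](oaut_fixX n ha) oaut_le; apply: le_trans cu; apply: ltW.
    by have := cn_gt 1; rewrite /cn expg1.
  by rewrite oaut_lt.
rewrite -(ler_pM2l d); apply: le_trans D _.
rewrite [X in _ <= X](_ : _ = C * (expR 1 * ((h ^+ n)%g v - (h ^+ n)%g u)) * (v - u)).
  by rewrite ler_wpM2r ?ler_wpM2l ?(ltW C0) //; lra.
by ring.
Qed.

(** If [l] moved [y] to the right, the disjoint intervals from [l ^+ m y] to [l ^+ m.+1 y] would all
    lie below [c]. Since the iterates of [l^-1] are uniformly Lipschitz, the lengths of these
    intervals are bounded below, which is absurd. *)
Lemma reverses_contraction_trivial (l : oaut R) x :
  C2_on a c h -> C2_on a c (h^-1)%g -> C2_on a c l -> C2_on a c (l^-1)%g ->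
  l c = c -> reverses h l -> h c <= x -> x <= c -> l x = x.
Proof.
have main (l' : oaut R) y : C2_on a c h -> C2_on a c (h^-1)%g -> C2_on a c l' ->
    C2_on a c (l'^-1)%g -> l' c = c -> reverses h l' -> h c <= y -> y <= c -> l' y <= y.
  move=> C2h C2hV C2l C2lV lc hl cy yc; rewrite leNgt; apply/negP => ly.
  have C2lVV : C2_on a c (l'^-1^-1)%g by rewrite invgK.
  have [C C0 lip] := reverses_iterates_lipschitz C2h C2hV C2lV C2lVV
    (oaut_fixV lc) (reversesV hl).
  have lhc : l' (h c) = h c by exact: reverses_fix_image hl lc.
  pose d := l' y - y; have d0 : 0 < d by rewrite subr_gt0.
  have Im m : d <= C * ((l' ^+ m.+1)%g y - (l' ^+ m)%g y).
    have := lip m ((l' ^+ m)%g y) ((l' ^+ m.+1)%g y).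
    rewrite -[X in X <= (l' ^+ m)%g y](oaut_fixX m lhc) oaut_le cy.
    rewrite [X in X <= c](_ : _ = (l' ^+ m)%g (l' y)); last by rewrite expgSr.
    rewrite -[X in _ <= X -> _](oaut_fixX m lc) oaut_le.
    rewrite -[X in _ <= X -> _]lc oaut_le yc.
    rewrite expgSr oautM oaut_lt ly => /(_ isT isT isT).
    by rewrite expVgn !oautK.
  have sum m : m%:R * d <= C * ((l' ^+ m)%g y - y).
    elim: m => [|m IH]; first by rewrite mul0r expg0 subrr mulr0.
    have := Im m; rewrite -natr1 mulrDl mul1r; lra.
  have bnd m : m%:R * d <= C * (c - y).
    apply: le_trans (sum m) _; rewrite ler_pM2l // lerD2r.
    by rewrite -[X in _ <= X](oaut_fixX m lc) oaut_le.
  have := archi_boundP (_ : 0 <= C * (c - y) / d).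
  rewrite divr_ge0 ?(ltW d0) ?mulr_ge0 ?(ltW C0) ?subr_ge0 // => /(_ isT).
  by rewrite ltr_pdivrMr // ltNge bnd.
move=> C2h C2hV C2l C2lV lc hl cx xc; apply/le_anti; rewrite main //=.
rewrite -oaut_leV main ?invgK //; first exact: oaut_fixV.
exact: reversesV.
Qed.

End Contraction.

(** If [y] moves [x], so does [q], and [y] moves [x] and [q x] in opposite directions. Hence [y] has
    a fixed point [c] between them, and the contraction result on the fundamental domain [q c, c]
    makes [y] fix [q x], a contradiction. *)
Lemma reverses_C2_trivial (q y : oaut R) p x : q p = p -> p <= x -> reverses q y ->
  C2_on p x q -> C2_on p x (q^-1)%g -> C2_on p x y -> C2_on p x (y^-1)%g -> y x = x.
Proof.
move=> qp px qy C2q C2qV C2y C2yV; apply: contrapT => yx.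
wlog qx : q qp qy C2q C2qV / q x < x.
  move=> H; case: (ltgtP (q x) x) => [|xq|qx].
  - exact: H.
  - apply: (H q^-1%g) => //; rewrite ?invgK //.
    + exact: oaut_fixV.
    + exact: reversesVl.
    + by rewrite oaut_ltV.
  - by apply: yx; exact: reverses_fix qy qx.
pose E := [set t | [/\ p <= t, t <= x & q t = t]]%classic.
have Es : has_sup E by split; [exists p | exists x => t []].
have Eub := sup_upper_bound Es.
(* The orbit of [x] under [q] decreases to a fixed point [a], and the bound [sup E] excludes any
   fixed point between [a] and [x]. *)
have [|n|a [ba ax qa]] := @oaut_orbit_lb R q x (sup E).
- exact: ltW.
- apply: ge_sup; first by exists p.
  by move=> t [_ tx qt]; rewrite -(oaut_fixX n qt) oaut_le.
have pa : p <= a by apply: le_trans ba; exact: Eub.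
have {}ax : a < x by rewrite lt_neqAle ax andbT; apply/eqP => e; move: qx; rewrite -e qa ltxx.
have qlt t : a < t -> t <= x -> q t < t.
  move=> at_ tx; rewrite ltNge; apply/negP => tq.
  have [z [tz zx qz]] := oaut_fix_between tx tq (ltW qx).
  have : z <= sup E by apply: Eub; split=> //; lra.
  lra.
have yq : y (q x) = q ((y^-1)%g x).
  by rewrite -!oautM (reversesV qy : _ = _) invgK.
have yqx : y (q x) <> q x.
  rewrite yq => /(can_inj (oautK q)) /oautE_V /esym; exact: yx.
have [c [qc cx yc]] : exists c, [/\ q x <= c, c <= x & y c = c].
  have [yx'|yx'] := leP x (y x).
    apply: oaut_fix_between' => //; first exact: ltW.
    by rewrite yq oaut_le oaut_leV.
  apply: oaut_fix_between; rewrite ?ltW //.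
  by rewrite yq oaut_lt oaut_ltV_r.
have {}cx : c < x by rewrite lt_neqAle cx andbT; apply/eqP => e; move: yc; rewrite e.
have {}qc : q x < c by rewrite lt_neqAle qc andbT; apply/eqP => e; move: yc; rewrite -e.
have ac : a < c by apply: lt_trans qc; rewrite -[X in X < _]qa oaut_lt.
apply: yqx; apply: (@reverses_contraction_trivial a c q ac qa _ y (q x)) => //.
- by move=> t at_ tc; apply: qlt => //; lra.
- by apply: C2_on_sub C2q; lra.
- by apply: C2_on_sub C2qV; lra.
- by apply: C2_on_sub C2y; lra.
- by apply: C2_on_sub C2yV; lra.
- by rewrite oaut_le ltW.
- exact: ltW.
Qed.

End Distortion.

(** * Actions by diffeomorphisms *)

Section Actions.
Variable R : realType.
Local Open Scope ring_scope.

(** [Q] displaces [t] and [V t] in opposite directions, so it has a fixed point between them; [t] is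
    chosen with both points at most [x]. *)
Lemma reverses_fix_le (V Q : oaut R) x : reverses V Q -> exists2 p, p <= x & Q p = p.
Proof.
move=> VQ; have E t : V (Q t) = (Q^-1)%g (V t) by rewrite -!oautM VQ.
pose t := Num.min x ((V^-1)%g x).
have tx : t <= x by rewrite ge_min lexx.
have Vtx : V t <= x by rewrite -oaut_leV_r ge_min lexx orbT.
have dn : Q t <= t -> V t <= Q (V t) by rewrite -(oaut_le V) E oaut_leV.
have up : t <= Q t -> Q (V t) <= V t by rewrite -(oaut_le V) E oaut_leV_r.
have [p [p1 p2 Qp]] : exists p, [/\ Num.min t (V t) <= p, p <= Num.max t (V t) & Q p = p].
  case: (leP t (V t)) => [tV|/ltW Vt]; case: (leP t (Q t)) => [Qt|/ltW Qt].
  - by apply: oaut_fix_between => //; exact: up.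
  - by apply: oaut_fix_between' => //; exact: dn.
  - by apply: oaut_fix_between' => //; exact: up.
  - by apply: oaut_fix_between => //; exact: dn.
by exists p => //; apply: le_trans p2 _; rewrite ge_max tx.
Qed.

Section AbstractRelations.
Variables (G : groupType) (v r z : G).
Hypotheses (vr : (v * r = r^-1 * v)%g) (rz : (r ^+ 2 * z = z^-1 * r ^+ 2)%g).
Hypothesis z2 : (z ^+ 2 <> 1)%g.

Lemma reversesX (H : groupType) (x y : H) n :
  (x * y = y^-1 * x -> x * y ^+ n = (y ^+ n)^-1 * x)%g.
Proof.
move=> xy; rewrite -expVgn; elim: n => [|n IH]; first by rewrite mulg1 mul1g.
by rewrite expgSr mulgA IH expgSr -!mulgA xy.
Qed.

Theorem no_line_action : ~ acts_faithfully_by G (@diffeo_line R).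
Proof.
move=> [rho [D rho1 rhoM rho_inj]].
have K g : cancel (rho g) (rho g^-1)%g by move=> x; rewrite -rhoM mulVg rho1.
have KV g : cancel (rho g^-1)%g (rho g) by move=> x; rewrite -rhoM mulgV rho1.
pose L g := OAut (K g) (KV g) (D g).1.
have LM g h : L (g * h)%g = (L g * L h)%g by apply: oaut_eq => x; exact: rhoM.
have LV g : L (g^-1)%g = ((L g)^-1)%g by apply: oaut_eq.
have LC g a b : C2_on a b (L g) by have [_ [g' [_ _ C _]]] := D g; exists (rho g).
have LR g h : (g * h = h^-1 * g)%g -> reverses (L g) (L h).
  by move=> E; rewrite /reverses -LV -!LM E.
apply: z2; apply: rho_inj => x; rewrite -[LHS]/(L (z ^+ 2)%g x).
(* [v] reverses [r ^+ 2], which thus has a fixed point below any [x]; [r ^+ 2] in turn reverses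
   [z ^+ 2]. *)
have [p px Lp] := reverses_fix_le x (LR _ _ (reversesX 2 vr)).
by apply: (reverses_C2_trivial Lp px (LR _ _ (reversesX 2 rz))); rewrite -?LV; exact: LC.
Qed.

Theorem no_interval_action : ~ acts_faithfully_by G (@diffeo_interval R).
Proof.
move=> [rho [D rho1 rhoM rho_inj]].
have K g : cancel (rho g) (rho g^-1)%g by move=> x; rewrite -rhoM mulVg rho1.
have KV g : cancel (rho g^-1)%g (rho g) by move=> x; rewrite -rhoM mulgV rho1.
pose L g := extend (K g) (KV g) (D g).1.
have LE g x : L g (set_val x) = set_val (rho g x) by exact: extendE.
have Lout g t : ~~ (0 <= t <= 1) -> L g t = t by exact: extend_fun_out.
have LV g : L (g^-1)%g = ((L g)^-1)%g by apply: oaut_eq.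
have LM g h : L (g * h)%g = (L g * L h)%g.
  apply: oaut_eq => x; rewrite oautM; have [p|p] := boolP (0 <= x <= 1).
    by rewrite -(to_unitIK p) !LE rhoM.
  by rewrite !Lout.
have LC g x : 0 <= x <= 1 -> C2_on 0 x (L g).
  move=> x01; have [_ [g' [_ _ [F [CF FE]] _]]] := D g; exists F => // t ht.
  have p : 0 <= t <= 1 by lra.
  by rewrite -(to_unitIK p) LE FE.
have LR g h : (g * h = h^-1 * g)%g -> reverses (L g) (L h).
  by move=> E; rewrite /reverses -LV -!LM E.
(* On the interval the endpoint 0, common to all elements, provides the fixed point of [r ^+ 2]. *)
have L0 g : L g 0 = 0.
  have p : (0 <= (0 : R)) && (0 <= (1 : R)) by rewrite lexx ler01.
  have ge0 h : 0 <= L h 0 by rewrite -{2}(to_unitIK p) LE; case/andP: (unitIP (rho h (to_unitI p))).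
  by apply/le_anti; rewrite ge0 andbT -oaut_leV_r -LV.
apply: z2; apply: rho_inj => x; apply: set_val_inj; rewrite -LE.
have x01 := unitIP x; have /andP[x0 _] := x01.
by apply: (reverses_C2_trivial (L0 _) x0 (LR _ _ (reversesX 2 rz))); rewrite -?LV; exact: LC.
Qed.

End AbstractRelations.

(** * Lifts of circle diffeomorphisms to the line *)

Lemma C2_shift (F : R -> R) c : C2 F -> C2 (fun t => F t + c).
Proof.
move=> [dF ddF cF].
have dc t : derivable (cst c : R -> R) t 1 by exact: derivable_cst.
have E : (fun t => F t + c)^`()%classic = F^`()%classic.
  apply/funext => t; rewrite !derive1E.
  by have := deriveD (dF t) (dc t); rewrite derive_cst addr0 => <-.
by split; rewrite ?E // => t; exact: derivableD (dF t) (dc t).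
Qed.

Lemma cos_sin_int (t : R) (k : int) :
  cos (t + 2 * pi * k%:~R) = cos t /\ sin (t + 2 * pi * k%:~R) = sin t.
Proof.
have N n (u : R) : cos (u + 2 * pi * n%:R) = cos u /\ sin (u + 2 * pi * n%:R) = sin u.
  rewrite mulr_natr mulr_natl.
  by split; [rewrite (periodicn (@cosD2pi R)) | rewrite (periodicn (@sinD2pi R))].
case: k => n; first exact: N.
have [N1 N2] := N n.+1 (t + 2 * pi * (Negz n)%:~R).
have E : t + 2 * pi * (Negz n)%:~R + 2 * pi * n.+1%:R = t.
  by rewrite NegzE mulrNz -pmulrn mulrN subrK.
by rewrite E in N1 N2.
Qed.

(** For the fractional part [th] of [s - t], the cosine of [2 * pi * th] is 1, whereas [0 < th < 1]
    would make the sine of [pi * th] positive. *)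
Lemma circle_exp_eq (s t : R) :
  circle_exp s = circle_exp t <-> exists k : int, s = t + k%:~R.
Proof.
split=> [/(congr1 val) /= [c1 s1]|[k ->]]; last first.
  apply: val_inj; rewrite /= mulrDr.
  by have [-> ->] := cos_sin_int (2 * pi * t) k.
have c : cos (2 * pi * (s - t)) = 1.
  by rewrite mulrBr cosB c1 s1 -!expr2 cos2Dsin2.
exists (Num.floor (s - t)); set k := Num.floor _.
pose th := s - t - k%:~R.
have th0 : 0 <= th by rewrite subr_ge0 floor_le.
have th1 : th < 1 by have := floorD1_gt (s - t); rewrite intrD -/k /th; lra.
have c' : cos (2 * pi * th) = 1.
  have [<- _] := cos_sin_int (2 * pi * th) k.
  by rewrite -mulrDr subrK.
have p0 : 0 < pi :> R := pi_gt0 R.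
suff th00 : th = 0 by move: th00 => /eqP; rewrite subr_eq0 subr_eq addrC => /eqP.
apply/eqP; rewrite eq_le th0 andbT leNgt; apply/negP => thpos.
have sp : 0 < sin (pi * th).
  by apply: sin_gt0_pi; rewrite mulr_gt0 //= gtr_pMr.
move: c'; rewrite -mulrA mulr_natl cos_mulr2n cos2sin2 => h.
have : 0 < sin (pi * th) ^+ 2 by rewrite exprn_gt0.
by lra.
Qed.

Lemma circle_exp_surj (x : circle R) : exists t, circle_exp t = x.
Proof.
have E : (val x).1 ^+ 2 + (val x).2 ^+ 2 = 1 by exact: set_valP x.
set a := (val x).1 in E; set b := (val x).2 in E.
have p2 : 2 * pi != 0 :> R by rewrite mulf_neq0 // gt_eqF // pi_gt0.
have a1 : -1 <= a <= 1 by apply/andP; split; have := sqr_ge0 b; nra.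
have sa : sin (acos a) = `|b|.
  rewrite sin_acos // -sqrtr_sqr; congr Num.sqrt; lra.
have ca : cos (acos a) = a by apply: acosK; rewrite in_itv.
have [b0|/ltW b0] := leP 0 b.
  exists (acos a / (2 * pi)); apply: val_inj; rewrite /= mulrC divfK //.
  by rewrite ca sa ger0_norm // /a /b -surjective_pairing.
exists (- acos a / (2 * pi)); apply: val_inj; rewrite /= mulrC divfK //.
by rewrite cosN sinN ca sa ler0_norm // opprK /a /b -surjective_pairing.
Qed.

(** Two distinct values would force, by the intermediate value theorem, a value halfway between two
    consecutive integers. *)
Lemma integer_valued_constant (D : R -> R) : continuous D ->
  (forall t, exists k : int, D t = k%:~R) -> exists k : int, forall t, D t = k%:~R.
Proof.
move=> cD ZD; have [k Dk] := ZD 0; exists k => t.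
have [l Dl] := ZD t; rewrite Dl; congr (_%:~R).
have nojump s s' m n : D s = m%:~R -> D s' = n%:~R -> ~ (m < n)%R.
  move=> Ds Ds' mn; pose w : R := m%:~R + 2^-1.
  have mw : (m%:~R : R) < w by rewrite ltrDl invr_gt0.
  have wn : w < (n%:~R : R).
    have : (m + 1)%:~R <= n%:~R :> R by rewrite ler_int lezD1.
    rewrite intrD => h; apply: lt_le_trans h; rewrite ltrD2l; lra.
  have notint (j : int) : w <> j%:~R.
    move=> wj; move: mw wn; rewrite wj ltr_int => mj _.
    have : (m + 1)%:~R <= j%:~R :> R by rewrite ler_int lezD1.
    by rewrite -wj intrD lerD2l; lra.
  have [x Dx] : exists x, D x = w.
    have cw a b : {within `[a, b], continuous D}%classic by exact: continuous_subspaceT.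
    have [ss|/ltW ss] := leP s s'.
      have [|x _ Dx] := @IVT R D s s' w ss (cw _ _); last by exists x.
      by rewrite Ds Ds' ge_min le_max (ltW mw) (ltW wn) orbT.
    have [|x _ Dx] := @IVT R D s' s w ss (cw _ _); last by exists x.
    by rewrite Ds Ds' ge_min le_max (ltW mw) (ltW wn) orbT.
  by have [j Dj] := ZD x; apply: (notint j); rewrite -Dx.
case: (ltgtP l k) => // lk; exfalso; first exact: nojump Dl Dk lk.
exact: nojump Dk Dl lk.
Qed.

Section Circle.
Variables (G : groupType) (rho : G -> circle R -> circle R).
Hypotheses (rhoD : forall g, diffeo_circle (rho g)) (rho1 : forall x, rho 1%g x = x).
Hypothesis rhoM : forall g h x, rho (g * h)%g x = rho g (rho h x).

Definition circle_lift (g : G) (L : oaut R) : Prop :=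
  forall t, rho g (circle_exp t) = circle_exp (L t).

Lemma lift_diff (F F' : R -> R) : continuous F -> continuous F' ->
  (forall t, circle_exp (F t) = circle_exp (F' t)) ->
  exists k : int, forall t, F t = F' t + k%:~R.
Proof.
move=> cF cF' E; have [|t|k hk] := @integer_valued_constant (fun t => F t - F' t).
- by move=> t; apply: cvgB; [exact: cF | exact: cF'].
- by have /circle_exp_eq[k ->] := E t; exists k; rewrite addrC addKr.
- by exists k => t; rewrite -(hk t) addrC subrK.
Qed.

Lemma C2_continuous (F : R -> R) : C2 F -> continuous F.
Proof. by move=> [dF _ _]; exact: derivable_continuous. Qed.

Lemma circle_lift_C2 g L : circle_lift g L -> C2 L.
Proof.
move=> gL; have [g' [_ _ [F [CF _ FE]] _]] := rhoD g.
have [t|k hk] := lift_diff (oaut_continuous (f := L)) (C2_continuous CF).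
  by rewrite -gL FE.
have -> : (L : R -> R) = (fun t => F t + k%:~R) by apply/funext.
exact: C2_shift.
Qed.

Lemma circle_lift_ex g : exists L, circle_lift g L.
Proof.
have [_ [_ _ [F [CF Flt FE]] _]] := rhoD g.
have [_ [_ _ [F' [CF' F'lt F'E]] _]] := rhoD g^-1%g.
have cF := C2_continuous CF; have cF' := C2_continuous CF'.
have cid : continuous (@id R) by move=> t; exact: cvg_id.
have [|t|k hk] := @lift_diff (F \o F') id _ cid.
- by move=> t; apply: continuous_comp; [exact: cF' | exact: cF].
- by rewrite /= -FE -F'E -rhoM mulgV rho1.
have [|t|j hj] := @lift_diff (F' \o F) id _ cid.
- by move=> t; apply: continuous_comp; [exact: cF | exact: cF'].
- by rewrite /= -F'E -FE -rhoM mulVg rho1.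
(* Lifts of an element and of its inverse compose to integer translations in both orders, so the
   first is bijective, with inverse the second up to a translation. *)
pose I t := F' t - j%:~R.
have FK : cancel F I by move=> t; rewrite /I; have /= -> := hj t; rewrite addrK.
have IK : cancel I F.
  move=> t; have Et : t = F (F' (t - k%:~R)) by have /= -> := hk (t - k%:~R); rewrite subrK.
  by rewrite {1}Et FK -Et.
by exists (OAut FK IK Flt) => t; rewrite FE.
Qed.

Lemma circle_liftM g h L M : circle_lift g L -> circle_lift h M ->
  circle_lift (g * h)%g (L * M)%g.
Proof. by move=> gL hM t; rewrite rhoM hM gL. Qed.

Lemma circle_liftV g L : circle_lift g L -> circle_lift g^-1%g L^-1%g.
Proof.
move=> gL t; rewrite -{1}(oautVK L t) -gL -rhoM mulVg rho1 //.
Qed.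

Lemma circle_liftX g L n : circle_lift g L -> circle_lift (g ^+ n)%g (L ^+ n)%g.
Proof.
move=> gL; elim: n => [|n IH]; first by move=> t; rewrite rho1.
by rewrite !expgS; exact: circle_liftM.
Qed.

Lemma circle_lift_unique g L M : circle_lift g L -> circle_lift g M ->
  exists k : int, forall t, L t = M t + k%:~R.
Proof.
move=> gL gM; apply: lift_diff; try exact: oaut_continuous.
by move=> t; rewrite -gL gM.
Qed.

(** A lift satisfies [L (t + 1) = L t + d] with a positive degree [d]. The degrees of [L] and of its
    inverse multiply to 1, so [d] is 1. *)
Lemma circle_lift_equivariant g L : circle_lift g L ->
  forall t (k : int), L (t + k%:~R) = L t + k%:~R.
Proof.
have step h M : circle_lift h M -> exists n : nat, forall t, M (t + 1) = M t + n.+1%:R.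
  move=> hM; have E t : M (t + 1) = (M * affine 1 ltr01)%g t.
    by rewrite oautM /= mul1r.
  have [t|k hk'] := lift_diff (oaut_continuous (f := (M * affine 1 ltr01)%g))
    (oaut_continuous (f := M)).
    by rewrite -E -!hM; congr (rho h _); apply/circle_exp_eq; exists 1.
  have hk t : M (t + 1) = M t + k%:~R by rewrite E.
  have : (0 : R) < k%:~R.
    by rewrite -(ltrD2l (M 0)) addr0 -hk oaut_lt add0r ltr01.
  rewrite ltr0z => k0; exists `|k - 1|%N => t; rewrite hk.
  by rewrite pmulrn; congr (_ + _%:~R); lia.
move=> gL; have [n hn] := step _ _ gL; have [m hm] := step _ _ (circle_liftV gL).
have nat_step j t : L (t + j%:R) = L t + (n.+1 * j)%:R.
  elim: j t => [|j IH] t; first by rewrite muln0 !addr0.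
  by rewrite -addn1 natrD addrA hn IH mulnDr muln1 natrD addrA.
have n0 : n = 0%N.
  have := nat_step m.+1 ((L^-1)%g 0); rewrite -hm !oautVK !add0r => /eqP.
  by rewrite (eqr_nat R 1) => /eqP; lia.
subst n; move=> t [j|j]; first by rewrite -pmulrn nat_step mul1n.
rewrite NegzE mulrNz -pmulrn; apply/eqP; rewrite eq_sym subr_eq; apply/eqP.
by rewrite -[j.+1]mul1n -nat_step mul1n subrK.
Qed.

Lemma circle_lift_shift g L (k : int) : circle_lift g L ->
  circle_lift g (affine k%:~R ltr01 * L)%g.
Proof.
by move=> gL t; rewrite gL; apply/circle_exp_eq; exists (- k); rewrite oautM /= mul1r mulrNz addrK.
Qed.

(* The lift is corrected by an integer translation before squaring its
   conjugation relation, since the relation holds only up to a translation. *)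
Lemma circle_reverses g h L M : circle_lift g L -> circle_lift h M ->
  (g * h = h^-1 * g)%g -> exists2 Q, circle_lift (h ^+ 2)%g Q & reverses L Q.
Proof.
move=> gL hM gh.
have lM := circle_liftM gL hM.
have lV := circle_liftM (circle_liftV hM) gL; rewrite -gh in lV.
have [k hk] := circle_lift_unique lM lV.
have eqv := circle_lift_equivariant.
have h2 := circle_liftX 2 hM.
(* With [L * M] equal to [M^-1 * L] followed by translation by [k], the lift [M ^+ 2 - k] of
   [h ^+ 2] is reversed exactly by [L]. *)
pose T : oaut R := affine (- k)%:~R ltr01.
have TE t : T t = t - k%:~R by rewrite /= mul1r mulrNz.
exists (T * M ^+ 2)%g; first exact: circle_lift_shift.
have LM t : L (M t) = (M^-1)%g (L t) + k%:~R by rewrite -[LHS]oautM hk oautM.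
have shiftL t : L (t - k%:~R) = L t - k%:~R by rewrite -mulrNz (eqv _ _ gL).
have QE t : (T * M ^+ 2)%g t = M (M t) - k%:~R by rewrite oautM TE expg2.
rewrite /reverses; apply: oaut_eq => t; rewrite [LHS]oautM [RHS]oautM.
apply/esym/oautE_V; rewrite !QE shiftL LM addrK oautVK LM (eqv _ _ hM) oautVK.
by rewrite addrK.
Qed.

End Circle.

Theorem no_circle_action (G : groupType) (v r z : G) :
  (v * r = r^-1 * v)%g -> (r ^+ 2 * z = z^-1 * r ^+ 2)%g -> (z ^+ 2 <> 1)%g ->
  ~ acts_faithfully_by G (@diffeo_circle R).
Proof.
move=> vr rz z2 [rho [D rho1 rhoM rho_inj]].
have [V vV] := circle_lift_ex D rho1 rhoM v.
have [P rP] := circle_lift_ex D rho1 rhoM r.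
have [Z zZ] := circle_lift_ex D rho1 rhoM z.
(* The correction is made twice, each time at the cost of a square: first for [r ^+ 2], then for
   [z ^+ 2], reversed by the chosen lift of [r ^+ 2]. *)
have [Q rQ VQ] := circle_reverses rho1 rhoM vV rP vr.
have [Y zY QY] := circle_reverses rho1 rhoM rQ zZ rz.
have C2L g L a b : circle_lift rho g L -> C2_on a b L.
  by move=> gL; exists L => //; apply: (circle_lift_C2 D) gL.
apply: z2; apply: rho_inj => x; have [t <-] := circle_exp_surj x; rewrite zY.
have [p pt Qp] := reverses_fix_le t VQ.
congr circle_exp; apply: (reverses_C2_trivial Qp pt QY).
- exact: C2L rQ.
- exact: C2L (circle_liftV rho1 rhoM rQ).
- exact: C2L zY.
- exact: C2L (circle_liftV rho1 rhoM zY).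
Qed.

End Actions.

(** * The square root of Thompson's group without faithful actions *)

Lemma homeo_of_gen (R : realType) (f g x : oaut R) :
  x \in gen_pred [set f; g]%classic ->
  homeo_of x \in gen_pred [set homeo_of f; homeo_of g]%classic.
Proof.
set S := [set homeo_of f; homeo_of g]%classic.
have [S1 SF] := gen_pred_closed S.
move=> /asboolP /(_ [pred y | homeo_of y \in gen_pred S]); apply.
  split=> [|y z yS zS]; first by rewrite unfold_in /= gmulf1.
  by rewrite unfold_in /= gmulfF; exact: SF.
by move=> y [->|->]; rewrite unfold_in /=; apply: gen_pred_mem; [left | right].
Qed.

Local Open Scope classical_set_scope.

Theorem corollary1p7 (R : realType) :
  exists f g : homeoI R,
    square_root f g /\
    ~ acts_faithfully_by (generated [set f; g]) (@diffeo_interval R) /\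
    ~ acts_faithfully_by (generated [set f; g]) (@diffeo_circle R) /\
    ~ acts_faithfully_by (generated [set f; g]) (@diffeo_line R).
Proof.
have [f [v [r [z [f2 fsupp [vg rg zg] [vr rz z2]]]]]] := root_with_reversed_elements R.
exists (homeo_of f), (homeo_of (pushL R)).
pose v' := Generated (homeo_of_gen vg); pose r' := Generated (homeo_of_gen rg).
pose z' := Generated (homeo_of_gen zg).
have valX (x : generated [set homeo_of f; homeo_of (pushL R)]) n :
    (val (x ^+ n) = val x ^+ n)%g by rewrite gmulfXn.
have valV (x : generated [set homeo_of f; homeo_of (pushL R)]) :
    (val x^-1 = (val x)^-1)%g by rewrite gmulfV.
(* The relations pass to the generated subgroup through the injective morphism [homeo_of] and the
   inclusion [val]. *)
have vr' : (v' * r' = r'^-1 * v')%g.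
  by apply: val_inj; rewrite !valM valV /= -gmulfM vr gmulfM gmulfV.
have rz' : (r' ^+ 2 * z' = z'^-1 * r' ^+ 2)%g.
  by apply: val_inj; rewrite [LHS]valM [RHS]valM valV valX /= -gmulfXn -gmulfM rz gmulfM gmulfV.
have z2' : (z' ^+ 2 <> 1)%g.
  move=> /(congr1 val); rewrite valX val1 /= -gmulfXn => e; apply: z2.
  by apply: homeo_of_inj; rewrite e gmulf1.
split; last split; last split.
- split.
    by rewrite -!gmulfXn f2; exact: push_iso.
  have -> : supp (homeo_of f) = (`]chart 0, 1[%classic : set R)%R.
    rewrite supp_homeo_of -chart_image_gt; congr (_ @` _).
    by apply/seteqP; split=> t; rewrite /= fsupp.
  have -> : supp (homeo_of (pushL R)) = (`]0, chart 3[%classic : set R)%R.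
    rewrite supp_homeo_of -chart_image_lt; congr (_ @` _).
    apply/seteqP; split=> t; last by move=> t3 e; have := pushL_gt t3; rewrite e ltxx.
    by move=> gt; rewrite /= ltNge; apply/negP => t3; exact: gt (pushL_fix t3).
  have /andP[c1 c2] := chart_itv (0%R : R); have /andP[c3 c4] := chart_itv (3%R : R).
  by apply: two_chain_overlap => //; rewrite chart_lt ltr0n.
- exact: no_interval_action rz' z2'.
- exact: no_circle_action vr' rz' z2'.
- exact: no_line_action vr' rz' z2'.
Qed.
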